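(* Let $(\varGamma,C)$ be a split-step SUSYQW with anisotropic coin $C$, and for $\sharp\in\{\mathrm L,\mathrm R\}$ let $U_\sharp=\varGamma\,\big(\bigoplus_{x\in\mathbb Z}C(\sharp)\big)$, i.e. $\varGamma$ composed with the constant coin equal to $C(\sharp)$ at every site. Then the essential spectrum of $U=\varGamma C$ is $\sigma_{\mathrm{ess}}(U)=\sigma(U_{\mathrm L})\cup\sigma(U_{\mathrm R})$, and $\sigma(U_\sharp)=\{z\in\mathbb C:|z|=1,\ \operatorname{Re}z\in I_\sharp\}$, where $I_\sharp=\{\pm1\}$ if $C(\sharp)$ is trivial and $I_\sharp=[\,p\,a(\sharp)-|q\,b(\sharp)|,\ p\,a(\sharp)+|q\,b(\sharp)|\,]$ otherwise.
   Context: Let $L$ be the left shift $(L\Psi)(x)=\Psi(x+1)$ on $\ell^2(\mathbb Z)$. A split-step SUSYQW is $\varGamma=\begin{pmatrix} p & qL\\ \overline{q}L^* & -p\end{pmatrix}$, $C=\begin{pmatrix} a_1 & \overline{b}\\ b & a_2\end{pmatrix}$ on $\ell^2(\mathbb Z,\mathbb C^2)\cong\ell^2(\mathbb Z)\oplus\ell^2(\mathbb Z)$ with $p\in\mathbb R$, $q\in\mathbb C\setminus\{0\}$, $p^2+|q|^2=1$, real sequences $a_1,a_2$ and complex sequence $b$ with $a_j(x)^2+|b(x)|^2=1$, $b(x)(a_1(x)+a_2(x))=0$. $C$ is anisotropic if $C(\mathrm L)=\lim_{x\to-\infty}C(x)$ and $C(\mathrm R)=\lim_{x\to+\infty}C(x)$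 exist, where $C(x)=\begin{pmatrix} a_1(x)&\overline{b(x)}\\ b(x)&a_2(x)\end{pmatrix}$; $b(\sharp)$ denotes the lower-left entry of $C(\sharp)$. A $2\times 2$ unitary Hermitian matrix is trivial if it equals $\pm I$; if $C(\sharp)$ is nontrivial then $a_1(\sharp)=-a_2(\sharp)=:a(\sharp)$. *)

(* Defs.v *)
From Stdlib Require Import Reals Lra List ZArith.
Open Scope R_scope.

Record Cplx := mkC { cre : R; cim : R }.
Definition C0 : Cplx := mkC 0 0.
Definition RtoC (r : R) : Cplx := mkC r 0.
Definition Cadd (z w : Cplx) : Cplx := mkC (cre z + cre w) (cim z + cim w).
Definition Csub (z w : Cplx) : Cplx := mkC (cre z - cre w) (cim z - cim w).
Definition Cmul (z w : Cplx) : Cplx :=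
  mkC (cre z * cre w - cim z * cim w) (cre z * cim w + cim z * cre w).
Definition Cconj (z : Cplx) : Cplx := mkC (cre z) (- cim z).
Definition Cnorm2 (z : Cplx) : R := cre z ^ 2 + cim z ^ 2.
Definition Cabs (z : Cplx) : R := sqrt (Cnorm2 z).

Definition vec : Type := (Cplx * Cplx)%type.
Definition vzero : vec := (C0, C0).
Definition vadd (u v : vec) : vec := (Cadd (fst u) (fst v), Cadd (snd u) (snd v)).
Definition vsub (u v : vec) : vec := (Csub (fst u) (fst v), Csub (snd u) (snd v)).
Definition vscale (c : Cplx) (v : vec) : vec := (Cmul c (fst v), Cmul c (snd v)).
Definition vnorm2 (v : vec) : R := Cnorm2 (fst v) + Cnorm2 (snd v).

Definition H : Type := Z -> vec.
Definition op : Type := H -> H.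

Fixpoint psum (f : Z -> R) (N : nat) : R :=
  match N with
  | O => f 0%Z
  | S n => psum f n + f (Z.of_nat (S n)) + f (- Z.of_nat (S n))%Z
  end.

Definition pnorm2 (psi : H) (N : nat) : R := psum (fun x => vnorm2 (psi x)) N.
Definition norm2_le (psi : H) (M : R) : Prop := forall N, pnorm2 psi N <= M.
Definition l2 (psi : H) : Prop := exists M, norm2_le psi M.
Definition heq (psi phi : H) : Prop := forall x, psi x = phi x.

Definition op_shift (T : op) (z : Cplx) : op :=
  fun psi x => vsub (T psi x) (vscale z (psi x)).

Definition in_resolvent (T : op) (z : Cplx) : Prop :=
  exists (S : op) (K : R),
    (forall psi M, l2 psi -> norm2_le psi M -> norm2_le (S psi) (K * M)) /\
    (forall psi, l2 psi -> heq (S (op_shift T z psi)) psi) /\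
    (forall psi, l2 psi -> heq (op_shift T z (S psi)) psi).

Definition spectrum (T : op) (z : Cplx) : Prop := ~ in_resolvent T z.

Definition is_eigvec (T : op) (z : Cplx) (psi : H) : Prop :=
  l2 psi /\ heq (T psi) (fun x => vscale z (psi x)).

Definition lincomb (cs : list Cplx) (vs : list H) (x : Z) : vec :=
  fold_right (fun cv acc => vadd (vscale (fst cv) ((snd cv) x)) acc) vzero
             (combine cs vs).

Definition finite_mult_eigenvalue (T : op) (z : Cplx) : Prop :=
  (exists psi, is_eigvec T z psi /\ exists x, psi x <> vzero) /\
  exists vs : list H, Forall l2 vs /\
    forall psi, is_eigvec T z psi ->
      exists cs : list Cplx, length cs = length vs /\ heq psi (lincomb cs vs).

Definition isolated_in_spectrum (T : op) (z : Cplx) : Prop :=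
  exists eps, 0 < eps /\
    forall w, spectrum T w -> Cabs (Csub w z) < eps -> w = z.

Definition disc_spectrum (T : op) (z : Cplx) : Prop :=
  spectrum T z /\ isolated_in_spectrum T z /\ finite_mult_eigenvalue T z.

Definition ess_spectrum (T : op) (z : Cplx) : Prop :=
  spectrum T z /\ ~ disc_spectrum T z.

(* coin operator C = (+)_x [[a1 x, conj (b x)], [b x, a2 x]] *)
Definition coin (a1 a2 : Z -> R) (b : Z -> Cplx) : op :=
  fun psi x =>
    (Cadd (Cmul (RtoC (a1 x)) (fst (psi x))) (Cmul (Cconj (b x)) (snd (psi x))),
     Cadd (Cmul (b x) (fst (psi x))) (Cmul (RtoC (a2 x)) (snd (psi x)))).

(* Gamma = [[p, q L], [conj q L^*, -p]],  (L psi)(x) = psi(x+1) *)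
Definition gamma (p : R) (q : Cplx) : op :=
  fun psi x =>
    (Cadd (Cmul (RtoC p) (fst (psi x))) (Cmul q (snd (psi (x + 1)%Z))),
     Csub (Cmul (Cconj q) (fst (psi (x - 1)%Z))) (Cmul (RtoC p) (snd (psi x)))).

Definition susyqw (p : R) (q : Cplx) (a1 a2 : Z -> R) (b : Z -> Cplx) : op :=
  fun psi => gamma p q (coin a1 a2 b psi).

Definition lim_minus_R (f : Z -> R) (l : R) : Prop :=
  forall eps, 0 < eps -> exists N : Z, forall x, (x <= N)%Z -> Rabs (f x - l) < eps.
Definition lim_plus_R (f : Z -> R) (l : R) : Prop :=
  forall eps, 0 < eps -> exists N : Z, forall x, (N <= x)%Z -> Rabs (f x - l) < eps.
Definition lim_minus_C (f : Z -> Cplx) (l : Cplx) : Prop :=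
  forall eps, 0 < eps -> exists N : Z, forall x, (x <= N)%Z -> Cabs (Csub (f x) l) < eps.
Definition lim_plus_C (f : Z -> Cplx) (l : Cplx) : Prop :=
  forall eps, 0 < eps -> exists N : Z, forall x, (N <= x)%Z -> Cabs (Csub (f x) l) < eps.

Definition coin_trivial (a1 a2 : R) (b : Cplx) : Prop :=
  b = C0 /\ ((a1 = 1 /\ a2 = 1) \/ (a1 = -1 /\ a2 = -1)).

(* r in I_sharp ; in the nontrivial case a(sharp) = a1(sharp) = - a2(sharp) *)
Definition in_band (p : R) (q : Cplx) (a1 a2 : R) (b : Cplx) (r : R) : Prop :=
  (coin_trivial a1 a2 b /\ (r = 1 \/ r = -1)) \/
  (~ coin_trivial a1 a2 b /\
     p * a1 - Cabs (Cmul q b) <= r /\ r <= p * a1 + Cabs (Cmul q b)).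

(* Main.v *)
Require Import Defs.
From Stdlib Require Import Reals ZArith.
From Stdlib Require Import Lra Lia Psatz List Classical ClassicalEpsilon.
From Stdlib Require Import FunctionalExtensionality ProofIrrelevance.
Open Scope R_scope.

(** Put [T = U - z]. The walk [U] is unitary, so [z] is in its spectrum iff [|z| = 1] and [T] is
    not bounded below, and a Landweber iteration inverts [T] when it is. The pivot is the
    property [ker_bound T]: every [u] lies within [K |T u|] of [ker T].

    If [z] is isolated in the spectrum, [T* T] has no spectrum in [(0, eps^2)], since
    [T* T - mu] factors through two points of the circle at distance [sqrt mu] from [z]; hence
    [|T* T u| >= eps |T u|], which gives [ker_bound T]. Conversely [ker_bound T] forces [z] to be
    isolated, and it holds as soon as [T] is bounded below on a subspace of finite codimension.

    If [z] is outside both asymptotic spectra, [T] is bounded below on the sequences that vanish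
    on a large box, so [z] is isolated with finite multiplicity (or not in the spectrum). If [z]
    is in the spectrum of [U_L] or [U_R], translating truncated approximate eigenvectors to
    infinity gives approximate eigenvectors of [U] with disjoint supports; a combination of them
    is orthogonal to any given finite-dimensional kernel, which contradicts [ker_bound T].

    For a nontrivial constant coin [U + U^-1 = 2 p a + q b L + conj (q b) L^*], and
    [Gamma U Gamma = U^-1] makes the spectrum symmetric; truncated plane waves fill the band. *)

(** * Hilbert spaces *)

(** The argument runs on norm estimates; spectral projections and compact perturbations never
    appear. For a bounded linear [T], [ker_bound T] says that the range of [T] is closed. For
    [T = U - z] with [|z| = 1] one has [T* = - conj z U^-1 T], so [T] and [T*] have the same kernel
    and the same lower bounds. This is why a one-sided lower bound already decides the resolvent
    set, and why the kernel bound is equivalent to [z] being isolated in the spectrum or outside it.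
    Keeping only the real part of the inner product makes all scalars real in the general part. A
    complex orthogonality condition against [v] then becomes two real ones, against [v] and [hJ v],
    and complex dimensions double, which does not affect finiteness. *)

(* A complex Hilbert space seen as a real one: [ip] is the real part of the inner product and
   [hJ] is the multiplication by [i]. *)
Record Hilbert := {
  hcar :> Type;
  hzero : hcar;
  hadd : hcar -> hcar -> hcar;
  hsc : R -> hcar -> hcar;
  hJ : hcar -> hcar;
  ip : hcar -> hcar -> R;
  ip_sym : forall u v, ip u v = ip v u;
  ip_zerol : forall v, ip hzero v = 0;
  ip_addl : forall u v w, ip (hadd u v) w = ip u w + ip v w;
  ip_scl : forall r u w, ip (hsc r u) w = r * ip u w;
  ip_Jr : forall u v, ip u (hJ v) = - ip (hJ u) v;
  ip_JJ : forall u v, ip (hJ (hJ u)) v = - ip u v;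
  ip_pos : forall u, 0 <= ip u u;
  ip_ext : forall u v, (forall w, ip u w = ip v w) -> u = v;
  hcomplete : forall s : nat -> hcar,
    (forall eps, 0 < eps -> exists N, forall n m, (N <= n)%nat -> (N <= m)%nat ->
       ip (hadd (s n) (hsc (-1) (s m))) (hadd (s n) (hsc (-1) (s m))) <= eps) ->
    exists l, forall eps, 0 < eps -> exists N, forall n, (N <= n)%nat ->
       ip (hadd l (hsc (-1) (s n))) (hadd l (hsc (-1) (s n))) <= eps }.

Arguments hzero {h} : simpl never.
Arguments hadd {h} : simpl never.
Arguments hsc {h} : simpl never.
Arguments hJ {h} : simpl never.
Arguments ip {h} : simpl never.

Declare Scope hilbert_scope.
Delimit Scope hilbert_scope with hil.
Notation "u +' v" := (hadd u v) (at level 50, left associativity) : hilbert_scope.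
Notation "r *' u" := (hsc r u) (at level 40, left associativity) : hilbert_scope.
Open Scope hilbert_scope.

Definition hsub {E : Hilbert} (u v : E) : E := u +' (-1) *' v.
Notation "u -' v" := (hsub u v) (at level 50, left associativity) : hilbert_scope.

Definition csc {E : Hilbert} (z : Cplx) (u : E) : E := cre z *' u +' cim z *' hJ u.

Arguments hsub : simpl never.
Arguments csc : simpl never.

Definition nrm {E : Hilbert} (u : E) : R := sqrt (ip u u).

Record clin (E : Hilbert) := {
  cl_fun :> E -> E;
  cl_add : forall u v, cl_fun (u +' v) = cl_fun u +' cl_fun v;
  cl_sc : forall r u, cl_fun (r *' u) = r *' cl_fun u;
  cl_J : forall u, cl_fun (hJ u) = hJ (cl_fun u) }.

Section Algebra.
Variable E : Hilbert.
Implicit Types u v w : E.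

Lemma ip_subl u v w : ip (u -' v) w = ip u w - ip v w.
Proof. unfold hsub. rewrite ip_addl, ip_scl. ring. Qed.

Lemma ip_cscl z u w : ip (csc z u) w = cre z * ip u w + cim z * ip (hJ u) w.
Proof. unfold csc. rewrite ip_addl, !ip_scl. ring. Qed.

Lemma ip_zeror u : ip u hzero = 0.
Proof. rewrite ip_sym. apply ip_zerol. Qed.

Lemma ip_addr u v w : ip w (u +' v) = ip w u + ip w v.
Proof. rewrite ip_sym, ip_addl, (ip_sym _ u), (ip_sym _ v). ring. Qed.

Lemma ip_scr r u w : ip w (r *' u) = r * ip w u.
Proof. rewrite ip_sym, ip_scl, (ip_sym _ u). ring. Qed.

Lemma ip_subr u v w : ip w (u -' v) = ip w u - ip w v.
Proof. rewrite ip_sym, ip_subl, (ip_sym _ u), (ip_sym _ v). ring. Qed.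

Lemma ip_cscr z u w : ip w (csc z u) = cre z * ip w u - cim z * ip (hJ w) u.
Proof. unfold csc. rewrite ip_addr, !ip_scr, ip_Jr. ring. Qed.

Lemma ip_Jl u v : ip (hJ u) v = - ip u (hJ v).
Proof. rewrite ip_Jr. ring. Qed.

Lemma hJ_zero : hJ (@hzero E) = hzero.
Proof. apply ip_ext; intro w. rewrite ip_Jl, !ip_zerol. ring. Qed.

Lemma hJ_add u v : hJ (u +' v) = hJ u +' hJ v.
Proof. apply ip_ext; intro w. rewrite ip_Jl, !ip_addl, !ip_Jr. ring. Qed.

Lemma hJ_sc r u : hJ (r *' u) = r *' hJ u.
Proof. apply ip_ext; intro w. rewrite ip_Jl, !ip_scl, !ip_Jr. ring. Qed.

Lemma hJ_sub u v : hJ (u -' v) = hJ u -' hJ v.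
Proof. apply ip_ext; intro w. rewrite ip_Jl, !ip_subl, !ip_Jr. ring. Qed.

Lemma hJ_csc z u : hJ (csc z u) = csc z (hJ u).
Proof. apply ip_ext; intro w. unfold csc. now rewrite hJ_add, !hJ_sc. Qed.

Lemma cl_sub (T : clin E) u v : T (u -' v) = T u -' T v.
Proof. unfold hsub. now rewrite cl_add, cl_sc. Qed.

Lemma cl_csc (T : clin E) z u : T (csc z u) = csc z (T u).
Proof. unfold csc. now rewrite cl_add, !cl_sc, cl_J. Qed.

Lemma cl_zero (T : clin E) : T hzero = hzero.
Proof.
  assert (h : hzero = 0 *' (@hzero E)).
  { apply ip_ext; intro. rewrite ip_scl, ip_zerol. ring. }
  rewrite h at 1. rewrite cl_sc. apply ip_ext; intro. rewrite ip_scl, ip_zerol. ring.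
Qed.

End Algebra.

Hint Rewrite ip_zerol ip_zeror ip_addl ip_addr ip_scl ip_scr ip_subl ip_subr ip_cscl
  ip_cscr ip_JJ ip_Jr hJ_zero hJ_add hJ_sc hJ_sub hJ_csc
  cl_add cl_sc cl_J cl_sub cl_csc cl_zero : hip.

Ltac hexpand := autorewrite with hip.
(** By [ip_ext], a vector identity follows from its pairings with an arbitrary test vector, where it
    is an identity between real polynomials. *)
Ltac hring := apply ip_ext; intro; hexpand; simpl; ring.

Section Norm.
Variable E : Hilbert.
Implicit Types u v w : E.

Lemma nrm_pos u : 0 <= nrm u.
Proof. apply sqrt_pos. Qed.

Lemma nrm_sq u : nrm u * nrm u = ip u u.
Proof. apply sqrt_sqrt, ip_pos. Qed.

(** Cauchy-Schwarz. Expanding the square of [|v| u - |u| v] gives [0 <= 2 |u||v| (|u||v| - ip u v)],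
    which is empty if a norm vanishes. In that case, were [ip u v] positive, a suitable [t] would
    make [|u + t v|^2] negative. *)
Lemma ip_le_nrm u v : ip u v <= nrm u * nrm v.
Proof.
  pose proof (nrm_pos u) as hu. pose proof (nrm_pos v) as hv.
  pose proof (nrm_sq u) as su. pose proof (nrm_sq v) as sv.
  pose proof (ip_pos E (nrm v *' u -' nrm u *' v)) as h.
  autorewrite with hip in h. rewrite (ip_sym _ v u), <- su, <- sv in h.
  destruct (Req_dec (nrm u * nrm v) 0) as [e|e].
  - assert (hz : forall t, 0 <= ip u u + 2 * t * ip u v + t * t * ip v v).
    { intro t. pose proof (ip_pos E (u +' t *' v)) as k.
      autorewrite with hip in k. rewrite (ip_sym _ v u) in k. lra. }
    apply Rmult_integral in e. rewrite <- su, <- sv in hz.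
    destruct e as [e|e]; rewrite e in *.
    + destruct (Rle_or_lt (ip u v) 0) as [|hp]; [lra|].
      specialize (hz (- (ip u v) / (1 + nrm v * nrm v))).
      set (d := 1 + nrm v * nrm v) in *.
      assert (hd : 1 <= d) by (unfold d; nra).
      assert (e2 : nrm v * nrm v = d - 1) by (unfold d; ring). rewrite e2 in hz.
      replace (0 * 0 + 2 * (- ip u v / d) * ip u v + - ip u v / d * (- ip u v / d) * (d - 1))
        with (- (ip u v * ip u v * (d + 1)) * (/ d * / d)) in hz by (field; lra).
      assert (0 < / d * / d) by (apply Rmult_lt_0_compat; apply Rinv_0_lt_compat; lra).
      assert (0 < ip u v * ip u v * (d+1)) by (apply Rmult_lt_0_compat; [nra|lra]). nra.
    + destruct (Rle_or_lt (ip u v) 0) as [|hp]; [lra|].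
      specialize (hz (- (nrm u * nrm u + 1) / (ip u v))).
      replace (nrm u * nrm u + 2 * (- (nrm u * nrm u + 1) / ip u v) * ip u v +
      - (nrm u * nrm u + 1) / ip u v * (- (nrm u * nrm u + 1) / ip u v) * (0 * 0))
      with (- nrm u * nrm u - 2) in hz by (field; lra). nra.
  - assert (0 < nrm u * nrm v) by nra. nra.
Qed.

Lemma abs_ip_le_nrm u v : Rabs (ip u v) <= nrm u * nrm v.
Proof.
  apply Rabs_le. split; [|apply ip_le_nrm].
  assert (h : nrm ((-1) *' u) = nrm u).
  { unfold nrm. f_equal. hexpand. ring. }
  pose proof (ip_le_nrm ((-1) *' u) v) as k. rewrite h in k. autorewrite with hip in k. lra.
Qed.

Lemma nrm_le_of_sq u r : 0 <= r -> ip u u <= r * r -> nrm u <= r.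
Proof. intros h k. rewrite <- (sqrt_square r h). now apply sqrt_le_1_alt. Qed.

Lemma nrm_sq_le u r : nrm u <= r -> ip u u <= r * r.
Proof. intro h. rewrite <- nrm_sq. pose proof (nrm_pos u). nra. Qed.

Lemma nrm_le_nrm u v : ip u u <= ip v v -> nrm u <= nrm v.
Proof. apply sqrt_le_1_alt. Qed.

Lemma nrm_add u v : nrm (u +' v) <= nrm u + nrm v.
Proof.
  pose proof (nrm_pos u). pose proof (nrm_pos v).
  apply nrm_le_of_sq; [lra|]. hexpand. rewrite (ip_sym _ v u).
  pose proof (ip_le_nrm u v). pose proof (nrm_sq u). pose proof (nrm_sq v). nra.
Qed.

Lemma nrm_sc r u : nrm (r *' u) = Rabs r * nrm u.
Proof.
  unfold nrm. hexpand. rewrite <- Rmult_assoc, sqrt_mult_alt by nra.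
  now rewrite <- sqrt_Rsqr_abs.
Qed.

Lemma nrm_sub_sym u v : nrm (u -' v) = nrm (v -' u).
Proof. unfold nrm. f_equal. hexpand. ring. Qed.

Lemma nrm_sub u v : nrm (u -' v) <= nrm u + nrm v.
Proof.
  unfold hsub. eapply Rle_trans; [apply nrm_add|]. rewrite nrm_sc.
  rewrite Rabs_left by lra. lra.
Qed.

Lemma nrm_sub_tri u v w : nrm (u -' w) <= nrm (u -' v) + nrm (v -' w).
Proof. replace (u -' w) with ((u -' v) +' (v -' w)) by hring. apply nrm_add. Qed.

Lemma nrm_le_sub u v : nrm u <= nrm (u -' v) + nrm v.
Proof. replace u with ((u -' v) +' v) at 1 by hring. apply nrm_add. Qed.

Lemma nrm_zero_eq u : nrm u <= 0 -> u = hzero.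
Proof.
  intro h. pose proof (nrm_pos u). apply ip_ext; intro w. rewrite ip_zerol.
  pose proof (abs_ip_le_nrm u w) as k. replace (nrm u) with 0 in k by lra.
  rewrite Rmult_0_l in k. pose proof (Rabs_pos (ip u w)).
  destruct (Req_dec (ip u w) 0) as [|n]; auto.
  apply Rabs_pos_lt in n. lra.
Qed.

Lemma nrm_zero : nrm (@hzero E) = 0.
Proof. unfold nrm. now rewrite ip_zerol, sqrt_0. Qed.

Lemma nrm_csc z u : nrm (csc z u) = Cabs z * nrm u.
Proof.
  unfold nrm, Cabs. rewrite <- sqrt_mult_alt.
  - f_equal. hexpand. rewrite (ip_Jl _ u u), ip_Jr. unfold Cnorm2.
    assert (h : ip (hJ u) u = 0) by (pose proof (ip_Jr E u u) as k; rewrite (ip_sym _ u) in k; lra).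
    rewrite h. ring.
  - unfold Cnorm2. nra.
Qed.

Lemma hsub_zero_eq u v : u -' v = hzero -> u = v.
Proof.
  intro h. apply ip_ext; intro w. apply (f_equal (fun t => ip t w)) in h.
  rewrite ip_subl, ip_zerol in h. lra.
Qed.

Lemma eq_of_nrm_small u v : (forall eps, 0 < eps -> nrm (u -' v) <= eps) -> u = v.
Proof.
  intro h. apply hsub_zero_eq, nrm_zero_eq. apply le_epsilon. intros e he.
  specialize (h e he). lra.
Qed.

Lemma hcomplete_nrm (s : nat -> E) :
  (forall eps, 0 < eps -> exists N, forall n m, (N <= n)%nat -> (N <= m)%nat ->
       nrm (s n -' s m) <= eps) ->
  exists l, forall eps, 0 < eps -> exists N, forall n, (N <= n)%nat -> nrm (l -' s n) <= eps.
Proof.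
  intro h. destruct (hcomplete E s) as [l hl].
  - intros e he. destruct (h (sqrt e)) as [N hN]; [now apply sqrt_lt_R0|].
    exists N. intros n m hn hm. specialize (hN n m hn hm).
    apply nrm_sq_le in hN. rewrite sqrt_sqrt in hN by lra. exact hN.
  - exists l. intros e he. destruct (hl (e * e)) as [N hN]; [nra|].
    exists N. intros n hn. apply nrm_le_of_sq; [lra|]. now apply hN.
Qed.

End Norm.

(** * Solving equations by successive corrections *)

Section Iteration.
Variable E : Hilbert.
Implicit Types u v w : E.

Definition bounded (B : R) (T : E -> E) : Prop := forall u, nrm (T u) <= B * nrm u.

Definition closed (P : E -> Prop) : Prop :=
  forall l, (forall eps, 0 < eps -> exists u, P u /\ nrm (l -' u) <= eps) -> P l.

(* Every [u] can be corrected, within [P], so that the residual [T u - phi] shrinks by the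
   factor [theta]; by completeness the corrections converge to an exact solution. *)
Lemma solve_by_correction (T : clin E) (B C theta : R) (phi : E) (P : E -> Prop) :
  bounded B T -> closed P -> 0 <= C -> 0 <= theta < 1 ->
  (forall u, P u -> exists u', P u' /\ nrm (T u' -' phi) <= theta * nrm (T u -' phi) /\
                               nrm (u' -' u) <= C * nrm (T u -' phi)) ->
  forall u, P u -> exists l, P l /\ T l = phi /\ nrm (l -' u) <= C / (1 - theta) * nrm (T u -' phi).
Proof.
  intros hB hP hC [ht0 ht1] hstep u0 hu0.
  assert (hf : exists f : E -> E, forall u, P u -> P (f u) /\
      nrm (T (f u) -' phi) <= theta * nrm (T u -' phi) /\
      nrm (f u -' u) <= C * nrm (T u -' phi)).
  { exists (fun u => epsilon (inhabits u) (fun u' => P u' /\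
      nrm (T u' -' phi) <= theta * nrm (T u -' phi) /\
                               nrm (u' -' u) <= C * nrm (T u -' phi))).
    intros u hu. apply epsilon_spec. now apply hstep. }
  destruct hf as [f hf].
  set (s := fix s n := match n with O => u0 | S n => f (s n) end).
  set (r0 := nrm (T u0 -' phi)).
  assert (hr0 : 0 <= r0) by apply nrm_pos.
  assert (hs : forall n, P (s n) /\ nrm (T (s n) -' phi) <= theta ^ n * r0).
  { induction n as [|n [h1 h2]].
    - split; [exact hu0|]. simpl. unfold r0. lra.
    - destruct (hf _ h1) as [k1 [k2 k3]]. split; [exact k1|].
      change (s (S n)) with (f (s n)). simpl. nra. }
  assert (hd : forall n, nrm (s (S n) -' s n) <= C * (theta ^ n * r0)).
  { intro n. destruct (hs n) as [h1 h2]. destruct (hf _ h1) as [k1 [k2 k3]].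
    change (s (S n)) with (f (s n)). nra. }
  set (D := C / (1 - theta)).
  assert (hD : D * (1 - theta) = C) by (unfold D; field; lra).
  assert (hD0 : 0 <= D) by (unfold D; apply Rmult_le_pos; [lra|left; apply Rinv_0_lt_compat; lra]).
  assert (hth : forall n, 0 <= theta ^ n) by (intro; now apply pow_le).
  (* Since [C = D (1 - theta)], each bound in [hd] is a difference of consecutive terms
     [D theta^n r0], so the sum telescopes. *)
  assert (hnm : forall n k, nrm (s (n + k)%nat -' s n) <= D * (theta ^ n - theta ^ (n + k)) * r0).
  { intros n. induction k as [|k IH].
    - rewrite Nat.add_0_r. replace (s n -' s n) with (@hzero E) by hring. rewrite nrm_zero. lra.
    - replace (n + S k)%nat with (S (n + k))%nat by lia.
      pose proof (nrm_sub_tri E (s (S (n + k))) (s (n + k)%nat) (s n)) as ht.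
      pose proof (hd (n + k)%nat) as h1. rewrite <- hD in h1.
      change (theta ^ S (n + k)) with (theta * theta ^ (n + k)). nra. }
  assert (hnm2 : forall n m, (n <= m)%nat -> nrm (s m -' s n) <= D * theta ^ n * r0).
  { intros n m hm. replace m with (n + (m - n))%nat by lia. eapply Rle_trans; [apply hnm|].
    pose proof (hth (n + (m - n))%nat). assert (0 <= D * r0) by nra. nra. }
  assert (hsmall : forall A eps, 0 <= A -> 0 < eps -> exists N, forall n, (N <= n)%nat ->
    A * theta ^ n <= eps).
  { intros A eps hA he. destruct (pow_lt_1_zero theta (Rabs_def1 _ _ ht1 ltac:(lra)) (eps / (A +
      1))) as [N hN].
    { apply Rdiv_lt_0_compat; lra. }
    exists N. intros n hn. specialize (hN n hn). rewrite Rabs_right in hN by (apply Rle_ge, hth).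
    apply Rmult_lt_compat_r with (r := A + 1) in hN; [|lra].
    replace (eps / (A + 1) * (A + 1)) with eps in hN by (field; lra). pose proof (hth n). nra. }
  destruct (hcomplete_nrm E s) as [l hl].
  { intros eps he. destruct (hsmall (D * r0) eps) as [N hN]; [nra|lra|].
    exists N. intros n m hn hm.
    destruct (Nat.le_ge_cases n m) as [c|c].
    - rewrite nrm_sub_sym. eapply Rle_trans; [apply hnm2, c|]. specialize (hN n hn). lra.
    - eapply Rle_trans; [apply hnm2, c|]. specialize (hN m hm). lra. }
  exists l. split; [|split].
  - apply hP. intros eps he. destruct (hl eps he) as [N hN]. exists (s N). split; [apply hs|].
    now apply hN.
  - apply eq_of_nrm_small. intros eps he.
    destruct (hsmall r0 (eps / 2)) as [N1 hN1]; [lra|lra|].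
    destruct (hl (eps / 2 / (Rabs B + 1))) as [N2 hN2].
    { pose proof (Rabs_pos B). apply Rdiv_lt_0_compat; lra. }
    set (n := Nat.max N1 N2). specialize (hN1 n (Nat.le_max_l _ _)).
    specialize (hN2 n (Nat.le_max_r _ _)).
    pose proof (nrm_sub_tri E (T l) (T (s n)) phi) as h. rewrite <- cl_sub in h.
    pose proof (hB (l -' s n)) as h2. destruct (hs n) as [_ h3].
    pose proof (Rle_abs B). pose proof (Rabs_pos B). pose proof (nrm_pos E (l -' s n)).
    assert (nrm (l -' s n) * (Rabs B + 1) <= eps / 2).
    { replace (eps / 2) with (eps / 2 / (Rabs B + 1) * (Rabs B + 1)) by (field; lra). nra. }
    nra.
  - apply le_epsilon. intros eps he. destruct (hl eps he) as [N hN].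
    specialize (hN N (Nat.le_refl _)).
    pose proof (nrm_sub_tri E l (s N) u0). pose proof (hnm2 0%nat N ltac:(lia)) as h2.
    simpl in h2. fold D. fold r0. lra.
Qed.

Lemma closed_all : closed (fun _ => True).
Proof. now intros l _. Qed.

Lemma closed_orthogonal (es : list E) : closed (fun u => Forall (fun e => ip u e = 0) es).
Proof.
  intros l h. apply Forall_forall. intros e he.
  assert (hz : forall eps, 0 < eps -> Rabs (ip l e) <= 0 + eps).
  { intros eps hp. pose proof (nrm_pos E e).
    destruct (h (eps / (nrm e + 1))) as [u [h1 h2]]; [apply Rdiv_lt_0_compat; lra|].
    rewrite Forall_forall in h1. specialize (h1 e he).
    replace (ip l e) with (ip (l -' u) e) by (rewrite ip_subl; lra).
    pose proof (abs_ip_le_nrm E (l -' u) e). pose proof (nrm_pos E (l -' u)).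
    assert (nrm (l -' u) * (nrm e + 1) <= eps).
    { replace eps with (eps / (nrm e + 1) * (nrm e + 1)) by (field; lra). nra. }
    lra. }
  apply le_epsilon in hz. pose proof (Rabs_pos (ip l e)).
  destruct (Req_dec (ip l e) 0) as [|n]; auto. apply Rabs_pos_lt in n. lra.
Qed.

(* The correction step is the gradient step [u - s T* (T u - phi)] for [|T u - phi|^2]. *)
Lemma landweber (T Ts : clin E) (B d : R) :
  bounded B T -> 0 <= B -> 0 < d -> (forall u v, ip (T u) v = ip u (Ts v)) ->
  exists K, 0 <= K /\ forall phi,
    (forall u, d * nrm (T u -' phi) <= nrm (Ts (T u -' phi))) ->
    forall u, exists l, T l = phi /\ nrm (l -' u) <= K * nrm (T u -' phi).
Proof.
  intros hB hB0 hd hadj.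
  assert (hBs : bounded B Ts).
  { intro v. pose proof (nrm_pos E (Ts v)) as h0. pose proof (nrm_pos E v) as h1.
    assert (h : nrm (Ts v) * nrm (Ts v) <= B * nrm (Ts v) * nrm v).
    { rewrite nrm_sq. rewrite <- hadj. eapply Rle_trans; [apply ip_le_nrm|].
      apply Rmult_le_compat_r; [lra|apply hB]. }
    destruct (Req_dec (nrm (Ts v)) 0) as [e|e]; [rewrite e; nra|].
    apply Rmult_le_reg_l with (nrm (Ts v)); lra. }
  (* For the residual [r], the new square is [|r|^2 - 2 s |T* r|^2 + s^2 |T T* r|^2]. As
     [s B^2 <= 1], it is at most [|r|^2 - s |T* r|^2 <= (1 - s d^2) |r|^2]. The term [d * d] keeps
     the denominator positive and [s d^2 <= 1]. *)
  set (s := / (B * B + d * d)).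
  assert (hp : 0 < B * B + d * d) by nra.
  assert (hs : 0 < s) by (now apply Rinv_0_lt_compat).
  assert (hs1 : s * (B * B + d * d) = 1) by (unfold s; field; lra).
  set (theta := sqrt (1 - s * (d * d))).
  assert (ht2 : 0 <= 1 - s * (d * d)) by nra.
  assert (ht : 0 <= theta < 1).
  { split; [apply sqrt_pos|]. rewrite <- sqrt_1. apply sqrt_lt_1; nra. }
  exists (s * B / (1 - theta)). split.
  { apply Rmult_le_pos; [nra|left; apply Rinv_0_lt_compat; lra]. }
  intros phi h u.
  destruct (solve_by_correction T B (s * B) theta phi (fun _ => True) hB closed_all)
    with (u := u) as [l [_ [h1 h2]]]; try tauto; try nra.
  2:{ exists l. split; auto. }
  clear u. intros u _. set (r := T u -' phi). exists (u -' s *' Ts r).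
  split; [trivial|]. specialize (h u). fold r in h.
  assert (e1 : T (u -' s *' Ts r) -' phi = r -' s *' T (Ts r)) by (unfold r; hring).
  split.
  - rewrite e1. pose proof (nrm_pos E r). apply nrm_le_of_sq; [apply Rmult_le_pos; lra|].
    replace (theta * nrm r * (theta * nrm r)) with ((theta * theta) * (nrm r * nrm r)) by ring.
    unfold theta at 1 2. rewrite sqrt_sqrt by lra.
    assert (e2 : ip (r -' s *' T (Ts r)) (r -' s *' T (Ts r)) =
      ip r r - 2 * s * ip (Ts r) (Ts r) + s * s * ip (T (Ts r)) (T (Ts r))).
    { hexpand. rewrite (ip_sym _ r (T (Ts r))), (hadj (Ts r) r). ring. }
    rewrite e2. clear e2. pose proof (hB (Ts r)) as k. rewrite <- !nrm_sq.
    pose proof (nrm_pos E (Ts r)). pose proof (nrm_pos E (T (Ts r))).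
    set (a := nrm (T (Ts r))) in *. set (b := nrm (Ts r)) in *. set (c := nrm r) in *.
    assert (a * a <= B * B * (b * b)) by nra.
    assert (d * d * (c * c) <= b * b) by (assert (0 <= d * c) by nra; nra).
    assert (s * s * (a * a) <= s * s * (B * B * (b * b))) by (apply Rmult_le_compat_l; nra).
    assert (s * s * (B * B * (b * b)) <= s * (b * b)).
    { replace (s * s * (B * B * (b * b))) with ((s * (B * B)) * (s * (b * b))) by ring.
      assert (s * (B * B) <= 1) by nra. assert (0 <= s * (b * b)) by nra. nra. }
    nra.
  - replace (u -' s *' Ts r -' u) with ((-s) *' Ts r) by hring.
    rewrite nrm_sc, Rabs_Ropp, Rabs_right by lra. pose proof (hBs r). nra.
Qed.

Definition ker_bound (T : E -> E) : Prop :=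
  exists K, 0 <= K /\ forall u, exists k, T k = hzero /\ nrm (u -' k) <= K * nrm (T u).

(** One orthogonality constraint is dropped here. [P] carries the constraints that remain, and the
    kernel corrections must stay in [P] for the step to be repeated. Either [P] lies in the
    hyperplane, or a kernel element off the hyperplane absorbs the new direction, or [T] is bounded
    below transversally to the hyperplane. *)
Lemma ker_bound_of_codim_one (T : clin E) (B K : R) (P : E -> Prop) (e : E) :
  bounded B T -> 0 <= K -> closed P ->
  (forall r u v, P u -> P v -> P (r *' u +' v)) ->
  (forall u, P u -> ip u e = 0 -> exists k, P k /\ ip k e = 0 /\ T k = hzero /\
    nrm (u -' k) <= K * nrm (T u)) ->
  exists K', 0 <= K' /\ forall u, P u -> exists k, P k /\ T k = hzero /\
    nrm (u -' k) <= K' * nrm (T u).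
Proof.
  intros hB hK hcl hlin h.
  destruct (classic (exists f, P f /\ ip f e <> 0)) as [[f [hf hfe]]|hn].
  2:{ exists K. split; [lra|]. intros u hu.
      destruct (h u hu) as [k hk]; [|exists k; tauto].
      apply NNPP. intro c. apply hn. exists u. tauto. }
  destruct (classic (exists k0, P k0 /\ ip k0 e <> 0 /\
    T k0 = hzero)) as [[k0 [hk0 [hk0e hk0T]]]|hno].
  { exists K. split; [lra|]. intros u hu. set (t := ip u e / ip k0 e).
    destruct (h ((-t) *' k0 +' u)) as [k [h1 [h2 [h3 h4]]]].
    - now apply hlin.
    - hexpand. unfold t. field. exact hk0e.
    - exists (t *' k0 +' k). split; [now apply hlin|]. split.
      + rewrite cl_add, cl_sc, hk0T, h3. hring.
      + replace (u -' (t *' k0 +' k)) with (((-t) *' k0 +' u) -' k) by hring.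
        replace (T u) with (T ((-t) *' k0 +' u)); [exact h4|].
        rewrite cl_add, cl_sc, hk0T. hring. }
  (* Without a kernel element off the hyperplane [e^perp], [T] maps a translate of the
     hyperplane to a set at positive distance from 0: otherwise [solve_by_correction] would
     produce such an element. *)
  assert (hdist : exists d, 0 < d /\ forall v, P v -> ip v e = 0 -> d <= nrm (T (f +' v))).
  { apply NNPP. intro hc. apply hno.
    assert (hall : forall d, 0 < d -> exists v, P v /\ ip v e = 0 /\ nrm (T (f +' v)) < d).
    { intros d hd. apply NNPP. intro hc2. apply hc. exists d. split; auto. intros v h1 h2.
      apply Rnot_lt_le. intro. apply hc2. exists v. auto. }
    destruct (hall 1 ltac:(lra)) as [v0 [hv0 [hv0e _]]].
    (* A solution [l] of [T l = - T f] in the hyperplane makes [f + l] a kernel element off it. *)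
    destruct (solve_by_correction T B (2 * K) (1/2) ((-1) *' T f) (fun u => P u /\ ip u e = 0))
      with (u := v0) as [l [[hl1 hl2] [hl3 _]]]; auto; try lra.
    - intros l hl. split.
      + apply hcl. intros eps he. destruct (hl eps he) as [u [? ?]]. exists u. tauto.
      + pose proof (closed_orthogonal (e :: nil) l) as hco.
        assert (hF : Forall (fun e => ip l e = 0) (e :: nil)).
        { apply hco. intros eps he. destruct (hl eps he) as [u [[? ?] ?]].
          exists u. split; auto. }
        now inversion hF.
    - intros u [hu hue].
      assert (er : forall u, T u -' (-1) *' T f = T (f +' u)) by (intro; hring).
      rewrite er. destruct (Req_dec (nrm (T (f +' u))) 0) as [z|z].
      { exists u. rewrite er, z. replace (u -' u) with (@hzero E) by hring. rewrite nrm_zero.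
        repeat split; auto; lra. }
      pose proof (nrm_pos E (T (f +' u))).
      destruct (hall (1/2 * nrm (T (f +' u)))) as [v [hv [hve hvl]]]; [lra|].
      (* The better vector [v] may be far from [u]. Removing the kernel part [k] of [v - u] leaves
         its image unchanged and brings it within [K |T (v - u)|] of [u], where [|T (v - u)|] is at
         most 3/2 of the old residual. *)
      destruct (h ((-1) *' u +' v)) as [k [h1 [h2 [h3 h4]]]].
      { now apply hlin. }
      { hexpand. lra. }
      exists ((-1) *' k +' v). split; [split|].
      + now apply hlin.
      + hexpand. lra.
      + rewrite er. replace (T (f +' ((-1) *' k +' v))) with (T (f +' v)).
        2:{ rewrite !cl_add, cl_sc, h3. hring. }
        split; [lra|].
        replace ((-1) *' k +' v -' u) with ((-1) *' u +' v -' k) by hring.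
        eapply Rle_trans; [exact h4|].
        replace (T ((-1) *' u +' v)) with (T (f +' v) -' T (f +' u)) by hring.
        pose proof (nrm_sub E (T (f +' v)) (T (f +' u))). nra.
    - exists (f +' l). split; [|split].
      + replace (f +' l) with (1 *' f +' l) by hring. now apply hlin.
      + hexpand. lra.
      + rewrite cl_add, hl3. hring. }
  destruct hdist as [d [hd hdist]].
  set (b := Rabs B * nrm f).
  assert (hb : nrm (T f) <= b).
  { unfold b. pose proof (hB f). pose proof (Rle_abs B). pose proof (nrm_pos E f). nra. }
  assert (hb0 : 0 <= b) by (pose proof (nrm_pos E (T f)); lra).
  (* From [u - k = t f + (v - k)] with [|t| <= |T u| / d] and [|T v| <= |T u| + |t| b]. *)
  exists (nrm f / d + K * (1 + b / d)).
  assert (hdi : 0 < / d) by now apply Rinv_0_lt_compat.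
  assert (hfd : 0 <= nrm f / d) by (apply Rmult_le_pos; [apply nrm_pos|lra]).
  assert (hbd : 0 <= b / d) by (apply Rmult_le_pos; lra).
  split; [nra|].
  intros u hu. set (t := ip u e / ip f e). set (v := (-t) *' f +' u).
  assert (hv : P v) by now apply hlin.
  assert (hve : ip v e = 0) by (unfold v; hexpand; unfold t; field; exact hfe).
  assert (htd : Rabs t * d <= nrm (T u)).
  { destruct (Req_dec t 0) as [z|z].
    { rewrite z, Rabs_R0. pose proof (nrm_pos E (T u)). lra. }
    replace u with (t *' (f +' (/ t) *' v)).
    2:{ unfold v. apply ip_ext; intro. hexpand. field. exact z. }
    rewrite cl_sc, nrm_sc. apply Rmult_le_compat_l; [apply Rabs_pos|]. apply hdist.
    (* Closure of [P] is stated for [r u + v] only, so the zero vector has to be produced inside [P]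
       first. *)
    - assert (hz : P ((-1) *' v +' v)) by now apply hlin.
      replace (/ t *' v) with (/ t *' v +' ((-1) *' v +' v)) by hring. now apply hlin.
    - hexpand. rewrite hve. ring. }
  assert (htd2 : Rabs t <= nrm (T u) / d).
  { apply Rmult_le_reg_r with d; [lra|]. unfold Rdiv. rewrite Rmult_assoc, Rinv_l by lra. lra. }
  destruct (h v hv hve) as [k [h1 [h2 [h3 h4]]]].
  exists k. split; [exact h1|]. split; [exact h3|].
  assert (hTv : nrm (T v) <= (1 + b / d) * nrm (T u)).
  { replace (T v) with ((-t) *' T f +' T u) by (unfold v; hring).
    eapply Rle_trans; [apply nrm_add|]. rewrite nrm_sc, Rabs_Ropp.
    pose proof (Rabs_pos t). pose proof (nrm_pos E (T f)). pose proof (nrm_pos E (T u)).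
    assert (Rabs t * nrm (T f) <= nrm (T u) / d * b) by (apply Rmult_le_compat; lra).
    unfold Rdiv in *. lra. }
  replace (u -' k) with (t *' f +' (v -' k)) by (unfold v; hring).
  eapply Rle_trans; [apply nrm_add|]. rewrite nrm_sc.
  assert (Rabs t * nrm f <= nrm (T u) / d * nrm f).
  { apply Rmult_le_compat_r; [apply nrm_pos|lra]. }
  assert (K * nrm (T v) <= K * ((1 + b / d) * nrm (T u))) by (apply Rmult_le_compat_l; lra).
  unfold Rdiv in *. lra.
Qed.

Lemma ker_bound_of_finite_codim (T : clin E) (B c : R) (es : list E) :
  bounded B T -> 0 < c ->
  (forall u, Forall (fun e => ip u e = 0) es -> c * nrm u <= nrm (T u)) ->
  ker_bound T.
Proof.
  intros hB hc h.
  (* Under all constraints the kernel correction is zero. This form of the bound is stable under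
     removing constraints, unlike the lower bound itself. *)
  assert (hg : exists K, 0 <= K /\ forall u, Forall (fun e => ip u e = 0) es ->
     exists k, Forall (fun e => ip k e = 0) es /\ T k = hzero /\ nrm (u -' k) <= K * nrm (T u)).
  { exists (/ c). split; [left; now apply Rinv_0_lt_compat|]. intros u hu. exists hzero.
    split; [|split].
    - apply Forall_forall. intros. apply ip_zerol.
    - apply cl_zero.
    - replace (u -' hzero) with u by hring. specialize (h u hu).
      apply Rmult_le_reg_l with c; [lra|]. rewrite <- Rmult_assoc, Rinv_r by lra. lra. }
  clear h. induction es as [|e es IH].
  - destruct hg as [K [hK hg]]. exists K. split; auto. intro u.
    destruct (hg u (Forall_nil _)) as [k [_ hk]]. exists k. exact hk.
  - apply IH. destruct hg as [K [hK hg]].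
    destruct (ker_bound_of_codim_one T B K (fun u => Forall (fun e => ip u e = 0) es) e hB hK
      (closed_orthogonal es)) as [K' hK'].
    + intros r u v hu hv. apply Forall_forall. intros x hx.
      rewrite Forall_forall in hu, hv. hexpand. rewrite (hu x hx), (hv x hx). ring.
    + intros u hu hue. destruct (hg u) as [k [h1 [h2 h3]]]; [now constructor|].
      inversion h1; subst. exists k. auto.
    + exists K'. exact hK'.
Qed.

Definition rcomb (cs : list R) (vs : list E) : E :=
  fold_right (fun cv acc => fst cv *' snd cv +' acc) hzero (combine cs vs).

(** Pairing with [es] embeds [P] into a finite-dimensional real space. Each pairing that does not
    vanish on the current subspace splits off one spanning vector. *)
Lemma finite_span (es : list E) : forall (P : E -> Prop),
  (forall r u v, P u -> P v -> P (r *' u +' v)) ->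
  (forall u, P u -> Forall (fun e => ip u e = 0) es -> u = hzero) ->
  exists vs, forall u, P u -> exists cs, length cs = length vs /\ u = rcomb cs vs.
Proof.
  induction es as [|e es IH]; intros P hlin h.
  - exists nil. intros u hu. exists nil. split; auto.
  - destruct (IH (fun u => P u /\ ip u e = 0)) as [vs hvs].
    + intros r u v [h1 h2] [h3 h4]. split; auto. hexpand. rewrite h2, h4. ring.
    + intros u [h1 h2] h3. apply h; auto.
    + destruct (classic (exists f, P f /\ ip f e <> 0)) as [[f [hf hfe]]|hn].
      * exists (f :: vs). intros u hu.
        set (t := ip u e / ip f e).
        destruct (hvs ((-t) *' f +' u)) as [cs [h1 h2]].
        { split; auto. hexpand. unfold t. field. exact hfe. }
        exists (t :: cs). split; [simpl; congruence|].
        unfold rcomb in *. simpl. rewrite <- h2. hring.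
      * exists vs. intros u hu. apply hvs. split; auto. apply NNPP. intro. apply hn. exists u. auto.
Qed.

End Iteration.
Arguments bounded {E}. Arguments ker_bound {E}. Arguments rcomb {E}.

(** * Spectral gaps of unitary operators *)

Lemma Cnorm2_pos z : 0 <= Cnorm2 z.
Proof. unfold Cnorm2. nra. Qed.

Lemma Cabs_pos z : 0 <= Cabs z.
Proof. apply sqrt_pos. Qed.

Lemma Cabs_sq z : Cabs z * Cabs z = Cnorm2 z.
Proof. apply sqrt_sqrt, Cnorm2_pos. Qed.

Lemma Cabs_conj z : Cabs (Cconj z) = Cabs z.
Proof. unfold Cabs, Cnorm2. simpl. f_equal. ring. Qed.

Lemma Cabs_sub_sym z w : Cabs (Csub z w) = Cabs (Csub w z).
Proof. unfold Cabs, Cnorm2. simpl. f_equal. ring. Qed.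

Lemma Cabs_eq_1 z : Cabs z = 1 -> Cnorm2 z = 1.
Proof. intro h. rewrite <- Cabs_sq, h. ring. Qed.

Lemma Cnorm2_eq_1 z : Cnorm2 z = 1 -> Cabs z = 1.
Proof. intro h. unfold Cabs. now rewrite h, sqrt_1. Qed.

Lemma Cabs_lt_of_sq z e : 0 < e -> Cnorm2 z < e * e -> Cabs z < e.
Proof.
  intros h k. unfold Cabs. rewrite <- (sqrt_square e) by lra. apply sqrt_lt_1; auto.
  - apply Cnorm2_pos.
  - nra.
Qed.

Lemma Cabs_sub_pos z w : z <> w -> 0 < Cabs (Csub z w).
Proof.
  intro h. apply sqrt_lt_R0. destruct z as [a b], w as [c d]. unfold Cnorm2; simpl.
  destruct (Req_dec a c) as [e|e]; [destruct (Req_dec b d) as [f|f]|].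
  - subst. congruence.
  - assert (k : b - d <> 0) by lra. apply Rsqr_pos_lt in k. unfold Rsqr in k.
    pose proof (Rle_0_sqr (a - c)) as k1. pose proof (Rle_0_sqr (b - d)) as k2.
    unfold Rsqr in k1, k2. nra.
  - assert (k : a - c <> 0) by lra. apply Rsqr_pos_lt in k. unfold Rsqr in k.
    pose proof (Rle_0_sqr (a - c)) as k1. pose proof (Rle_0_sqr (b - d)) as k2.
    unfold Rsqr in k1, k2. nra.
Qed.

(* Proves an equation that is the combination of [h1 : a = b] and [h2 : c = d] with the
   coefficients [k1], [k2]. *)
Ltac ideal2 h1 k1 h2 k2 :=
  match type of h1 with ?a = ?b => match type of h2 with ?c = ?d =>
    apply Rminus_diag_uniq; transitivity (k1 * (a - b) + k2 * (c - d));
    [ring | rewrite (Rminus_diag_eq _ _ h1), (Rminus_diag_eq _ _ h2); ring]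
  end end.

Section Abstract.
Variable E : Hilbert.
Implicit Types u v : E.

(** If [c] is the best constant in [c |u| <= |A u|], then [c] or [-c] belongs to the spectrum of
    [A]. When [c < m], both [A - c] and [A + c] are bounded below, and [c] can be improved. *)
Lemma selfadjoint_gap (A : clin E) (M m : R) :
  bounded M A -> (forall u v, ip (A u) v = ip u (A v)) -> 0 <= m ->
  (forall t, Rabs t < m -> exists c, 0 < c /\ forall u, c * nrm u <= nrm (A u -' t *' u)) ->
  forall u, m * nrm u <= nrm (A u).
Proof.
  intros hM hsa hm hgap u0. apply Rnot_lt_le. intro hlt.
  pose proof (nrm_pos E u0) as hp0. pose proof (nrm_pos E (A u0)) as hpA.
  assert (hu0 : 0 < nrm u0).
  { destruct (Req_dec (nrm u0) 0) as [z|z]; [rewrite z in hlt; lra|lra]. }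
  assert (hlt2 : ip (A u0) (A u0) < m * m * ip u0 u0).
  { rewrite <- !nrm_sq. nra. }
  assert (hi0 : 0 < ip u0 u0) by (rewrite <- nrm_sq; nra).
  set (S := fun t => forall u, t * ip u u <= ip (A u) (A u)).
  destruct (completeness S) as [c2 [hub hlub]].
  { exists (m * m). intros t ht. specialize (ht u0). nra. }
  { exists 0. intro u. pose proof (ip_pos E (A u)). lra. }
  assert (hcS : S c2).
  { intro u. pose proof (ip_pos E u) as hp. destruct (Req_dec (ip u u) 0) as [z|z].
    { rewrite z, Rmult_0_r. apply ip_pos. }
    assert (k : c2 <= ip (A u) (A u) / ip u u).
    { apply hlub. intros t ht. specialize (ht u). apply Rmult_le_reg_r with (ip u u); [lra|].
      unfold Rdiv. rewrite Rmult_assoc, Rinv_l by lra. lra. }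
    apply Rmult_le_compat_r with (r := ip u u) in k; [|lra].
    unfold Rdiv in k. rewrite Rmult_assoc, Rinv_l in k by lra. lra. }
  assert (hc0 : 0 <= c2).
  { apply hub. intro u. pose proof (ip_pos E (A u)). lra. }
  assert (hcm : c2 < m * m) by (apply Rmult_lt_reg_r with (ip u0 u0); [lra|]; pose proof (hcS u0);
    lra).
  set (c := sqrt c2).
  assert (hc : c * c = c2) by (apply sqrt_sqrt; lra).
  assert (hcp : 0 <= c) by apply sqrt_pos.
  assert (hcm2 : c < m) by nra.
  destruct (hgap c) as [k1 [hk1 h1]]; [rewrite Rabs_right; lra|].
  destruct (hgap (-c)) as [k2 [hk2 h2]]; [rewrite Rabs_Ropp, Rabs_right; lra|].
  (* [D = A^2 - c^2] is nonnegative and bounded below, hence coercive: [c^2] is not optimal. *)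
  set (D := fun u => A (A u) -' c2 *' u).
  assert (hD : forall u, k2 * k1 * nrm u <= nrm (D u)).
  { intro u. replace (D u) with (A (A u -' c *' u) -' (-c) *' (A u -' c *' u)).
    2:{ unfold D. rewrite <- hc. hring. }
    eapply Rle_trans; [|apply h2]. specialize (h1 u). nra. }
  assert (hM0 : 0 < Rabs M + 1) by (pose proof (Rabs_pos M); lra).
  set (L := (Rabs M + 1) * (Rabs M + 1)).
  assert (hL : 0 < L) by (unfold L; nra).
  assert (hDle : forall y, ip (D y) y <= L * ip y y).
  { intro y. unfold D. hexpand. rewrite hsa. pose proof (ip_pos E y).
    assert (ip (A y) (A y) <= L * ip y y).
    { unfold L. rewrite <- !nrm_sq. specialize (hM y). pose proof (nrm_pos E y).
      pose proof (nrm_pos E (A y)). pose proof (Rle_abs M).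
      assert (nrm (A y) <= (Rabs M + 1) * nrm y) by nra. nra. }
    nra. }
  assert (hDsa : forall u v, ip (D u) v = ip u (D v)).
  { intros u v. unfold D. hexpand. rewrite !hsa. ring. }
  assert (hD0 : forall y, 0 <= ip (D y) y).
  { intro y. unfold D. hexpand. rewrite hsa. specialize (hcS y). lra. }
  set (s := / L). assert (hs : 0 < s) by now apply Rinv_0_lt_compat.
  assert (hsL : s * L = 1) by (unfold s; field; lra).
  (* For [0 <= D <= L] one has [D^2 <= L D]; it is read off from the positivity of [D] at
     [u - D u / L]. With the lower bound [hD] on [|D u|] it gives coercivity. *)
  assert (hco : forall u, s * ip (D u) (D u) <= ip (D u) u).
  { intro u. pose proof (hD0 (u -' s *' D u)) as k. pose proof (hDle (D u)) as k2'.
    rewrite hDsa in k.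
    replace (D (u -' s *' D u)) with (D u -' s *' D (D u)) in k by (unfold D; hring).
    autorewrite with hip in k. rewrite <- (hDsa u (D u)), <- (hDsa u u) in k.
    rewrite (ip_sym E (D u) (D (D u))) in k.
    assert (s * s * ip (D (D u)) (D u) <= s * s * (L * ip (D u) (D u))).
    { apply Rmult_le_compat_l; nra. }
    replace (s * s * (L * ip (D u) (D u))) with (s * L * s * ip (D u) (D u)) in H by ring.
    rewrite hsL in H. lra. }
  assert (hbad : S (c2 + s * (k2 * k1 * (k2 * k1)))).
  { intro u. specialize (hco u). specialize (hD u).
    assert (e : ip (D u) u = ip (A u) (A u) - c2 * ip u u).
    { unfold D. hexpand. rewrite hsa. ring. }
    rewrite e in hco.
    assert (k2 * k1 * (k2 * k1) * ip u u <= ip (D u) (D u)).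
    { rewrite <- !nrm_sq. pose proof (nrm_pos E u).
      replace (k2 * k1 * (k2 * k1) * (nrm u * nrm u))
        with (k2 * k1 * nrm u * (k2 * k1 * nrm u)) by ring.
      assert (0 < k2 * k1) by nra. apply Rmult_le_compat; nra. }
    nra. }
  apply hub in hbad. assert (0 < k2 * k1) by nra.
  assert (0 < s * (k2 * k1 * (k2 * k1))) by (apply Rmult_lt_0_compat; nra).
  lra.
Qed.

Lemma ker_bound_orthogonal (T : E -> E) K u :
  (exists k, T k = hzero /\ nrm (u -' k) <= K * nrm (T u)) ->
  (forall k, T k = hzero -> ip u k = 0) -> nrm u <= K * nrm (T u).
Proof.
  intros [k [hk h]] ho. eapply Rle_trans; [|exact h]. apply nrm_le_nrm.
  hexpand. rewrite (ip_sym E k u), (ho k hk). pose proof (ip_pos E k). lra.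
Qed.

(** Two vectors are enough to cancel one pairing, so the induction over [vs] takes its hypothesis at
    two places [n] and [n']. Here [n] stands for how far out a vector lives, and [n'] depends on the
    first vector so that the second is out of its reach. *)
Lemma orthogonal_choice (sing : nat -> E -> Prop) (vs : list E) :
  (forall n, exists u, sing n u) ->
  (forall n u, sing n u -> exists n', forall u', sing n' u' ->
     forall a b, (a <> 0 \/ b <> 0) -> sing n (a *' u +' b *' u')) ->
  forall n, exists u, sing n u /\ Forall (fun v => ip u v = 0) vs.
Proof.
  intros h1 h2. induction vs as [|v vs IH]; intro n.
  - destruct (h1 n) as [u hu]. exists u. auto.
  - destruct (IH n) as [u [hu hv]]. destruct (h2 n u hu) as [n' hn'].
    destruct (IH n') as [u' [hu' hv']].
    destruct (Req_dec (ip u v) 0) as [z|z].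
    { exists u. auto. }
    exists (ip u' v *' u +' (- ip u v) *' u'). split.
    + apply hn'; auto. right. lra.
    + constructor; [hexpand; ring|]. rewrite Forall_forall in *. intros x hx.
      hexpand. rewrite (hv x hx), (hv' x hx). ring.
Qed.

Definition shift (T : clin E) (z : Cplx) : clin E.
Proof.
  refine {| cl_fun := fun u => T u -' csc z u |}; intros; hring.
Defined.

Lemma shiftE (T : clin E) z u : shift T z u = T u -' csc z u.
Proof. reflexivity. Qed.

Variables U V : clin E.
Hypothesis UV : forall u, U (V u) = u.
Hypothesis VU : forall u, V (U u) = u.
Hypothesis ipUU : forall u v, ip (U u) (U v) = ip u v.

Lemma ipUl u v : ip (U u) v = ip u (V v).
Proof. rewrite <- (UV v) at 1. apply ipUU. Qed.

Lemma ipVV u v : ip (V u) (V v) = ip u v.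
Proof. rewrite <- ipUU, !UV. reflexivity. Qed.

Lemma nrmU u : nrm (U u) = nrm u.
Proof. unfold nrm. now rewrite ipUU. Qed.

Lemma nrmV u : nrm (V u) = nrm u.
Proof. unfold nrm. now rewrite ipVV. Qed.

Definition bounded_below (z : Cplx) : Prop := exists c, 0 < c /\
  forall u, c * nrm u <= nrm (shift U z u).

Lemma shift_adj z u v : ip (shift U z u) v = ip u (shift V (Cconj z) v).
Proof. simpl. hexpand. rewrite ipUl. simpl. rewrite (ip_Jl E u v), ip_Jr. ring. Qed.

Lemma shift_bounded z : bounded (1 + Cabs z) (shift U z).
Proof.
  intro u. simpl. eapply Rle_trans; [apply nrm_sub|]. rewrite nrmU, nrm_csc. lra.
Qed.

Lemma shift_change (z w : Cplx) u : shift U w u = shift U z u -' csc (Csub w z) u.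
Proof. simpl. hring. Qed.

(** On the circle, [U^-1 - conj z = - conj z U^-1 (U - z)]: the adjoint of [U - z] is a unitary
    multiple of it. *)
Lemma nrm_shiftV z u : Cabs z = 1 -> nrm (shift V (Cconj z) u) = nrm (shift U z u).
Proof.
  intro h. rewrite <- (nrmV (shift U z u)).
  rewrite <- (Rmult_1_l (nrm (V _))), <- h, <- (Cabs_conj z), <- nrm_csc.
  replace (csc (Cconj z) (V (shift U z u))) with ((-1) *' shift V (Cconj z) u).
  - rewrite nrm_sc, Rabs_left by lra. ring.
  - apply Cabs_eq_1 in h. unfold Cnorm2 in h. apply ip_ext; intro. simpl. hexpand. rewrite VU.
    simpl.
    pose proof (eq_refl 0) as e0. ideal2 h (ip (V u) w) e0 0.
Qed.

Lemma shift_off_circle z u : Rabs (1 - Cabs z) * nrm u <= nrm (shift U z u).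
Proof.
  simpl. pose proof (nrm_le_sub E (U u) (csc z u)) as h.
  pose proof (nrm_le_sub E (csc z u) (U u)) as k.
  rewrite nrm_sub_sym in k. rewrite nrmU, nrm_csc in *.
  unfold Rabs. destruct (Rcase_abs _); lra.
Qed.

Lemma bounded_below_off_circle z : Cabs z <> 1 -> bounded_below z.
Proof.
  intro h. exists (Rabs (1 - Cabs z)). split; [apply Rabs_pos_lt; lra|]. apply shift_off_circle.
Qed.
(** Since [z z' = 1], the product is [U (U + U^-1 - (z + z'))]; the hypothesis on imaginary parts
    makes [z + z'] real. It is applied with [z' = conj z] on the circle. *)
Lemma shift_shift z z' u :
  Cmul z z' = RtoC 1 -> cim z' = - cim z ->
  shift U z (shift U z' u) = U (U u +' V u -' (cre z + cre z') *' u).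
Proof.
  intros hm hi.
  pose proof (f_equal cre hm) as m1. pose proof (f_equal cim hm) as m2. simpl in m1, m2.
  apply ip_ext; intro x. simpl. hexpand. rewrite UV, hi in *.
  ideal2 m1 (ip u x) m2 (ip (hJ u) x).
Qed.

Lemma shift_comm z z' u : shift U z (shift U z' u) = shift U z' (shift U z u).
Proof. simpl. hring. Qed.

End Abstract.
Arguments shift {E}. Arguments bounded_below {E}.

Section Unitary.
Variable E : Hilbert.
Implicit Types u v : E.
Variables U V : clin E.
Hypothesis UV : forall u, U (V u) = u.
Hypothesis VU : forall u, V (U u) = u.
Hypothesis ipUU : forall u v, ip (U u) (U v) = ip u v.
Hint Rewrite UV VU : hip.

(** Surjectivity needs a lower bound for the adjoint: on the circle it is the one for [U - z], off
    the circle it is [|1 - |z||]. The iteration then starts at zero. *)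
Lemma bounded_below_solve z : bounded_below U z ->
  exists K, 0 <= K /\ forall phi, exists u, shift U z u = phi /\ nrm u <= K * nrm phi.
Proof.
  intros [c [hc h]].
  assert (hV : exists d, 0 < d /\ forall u, d * nrm u <= nrm (shift V (Cconj z) u)).
  { destruct (Req_dec (Cabs z) 1) as [e|e].
    - exists c. split; auto. intro u. erewrite nrm_shiftV; eauto.
    - exists (Rabs (1 - Cabs z)). split; [apply Rabs_pos_lt; lra|].
      rewrite <- (Cabs_conj z). apply shift_off_circle. eapply ipVV; eauto. }
  destruct hV as [d [hd hV]].
  destruct (landweber E (shift U z) (shift V (Cconj z)) (1 + Cabs z) d) as [K [hK hl]]; auto.
  - eapply shift_bounded; eauto.
  - pose proof (Cabs_pos z). lra.
  - intros. eapply shift_adj; eauto.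
  - exists K. split; auto. intro phi. destruct (hl phi) with (u := @hzero E) as [l [h1 h2]].
    + intro u. apply hV.
    + exists l. split; auto. rewrite cl_zero in h2.
      replace (l -' hzero) with l in h2 by hring.
      replace (nrm (hzero -' phi)) with (nrm phi) in h2; auto.
      rewrite nrm_sub_sym. f_equal. hring.
Qed.

Lemma isolated_ker_bound z eps : Cabs z = 1 -> 0 < eps ->
  (forall w, Cabs (Csub w z) < eps -> w <> z -> bounded_below U w) -> ker_bound (shift U z).
Proof.
  (* Capping at 1 keeps [mu < 4] below, so that two points of the circle really lie at distance
     [sqrt mu] from [z]. *)
  intros hz heps hiso. set (e := Rmin eps 1).
  assert (he : 0 < e) by (apply Rmin_glb_lt; lra).
  assert (he1 : e <= 1) by apply Rmin_r.
  assert (hee : e <= eps) by apply Rmin_l.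
  (* The midpoint of the gap [(0, e^2)] of [T* T]: the operator [A = T* T - m] has the symmetric gap
     [(-m, m)]. *)
  set (m := e * e / 2).
  assert (hm : 0 < m) by (unfold m; nra).
  pose proof (Cabs_eq_1 z hz) as hz2. unfold Cnorm2 in hz2.
  assert (hTs : forall u, nrm (shift V (Cconj z) u) = nrm (shift U z u)).
  { intro. eapply nrm_shiftV; eauto. }
  assert (hadj : forall u v, ip (shift U z u) v = ip u (shift V (Cconj z) v)).
  { intros. eapply shift_adj; eauto. }
  assert (hTb : bounded (1 + Cabs z) (shift U z)) by (eapply shift_bounded; eauto).
  rewrite hz in hTb.
  assert (hA : exists A : clin E, forall u, A u = shift V (Cconj z) (shift U z u) -' m *' u).
  { unshelve eexists {| cl_fun := fun u => shift V (Cconj z) (shift U z u) -' m *' u |};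
      intros; try reflexivity; hring. }
  destruct hA as [A hA].
  assert (hlow : forall u, m * nrm u <= nrm (A u)).
  { apply (selfadjoint_gap E A (4 + m)).
    - intro u. rewrite hA. eapply Rle_trans; [apply nrm_sub|].
      rewrite hTs, nrm_sc, (Rabs_right m) by lra.
      pose proof (hTb u). pose proof (hTb (shift U z u)). lra.
    - intros u v. rewrite !hA. rewrite ip_subl, ip_subr, ip_scl, ip_scr.
      rewrite (ip_sym E (shift V _ _) v), <- !hadj, (ip_sym E (shift U z v)). ring.
    - lra.
    - intros t ht. apply Rabs_def2 in ht. set (mu := m + t).
      assert (hmu : 0 < mu < e * e) by (unfold mu, m in *; lra).
      assert (e * e <= 1) by nra.
      (* A point [z (al + i be)] of the circle is at squared distance [2 - 2 al] from [z]; [al]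
         makes this equal to [mu]. *)
      set (al := 1 - mu / 2). set (be := sqrt (1 - al * al)).
      assert (hal : 0 < 1 - al * al).
      { replace (1 - al * al) with (mu * (1 - mu / 4)) by (unfold al; field).
        apply Rmult_lt_0_compat; lra. }
      assert (hbe : be * be = 1 - al * al) by (apply sqrt_sqrt; lra).
      assert (hroot : forall w, Cnorm2 (Csub w z) = mu -> exists c, 0 < c /\
        forall u, c * nrm u <= nrm (shift U w u)).
      { intros w hw. apply hiso.
        - apply Rlt_le_trans with e; auto. apply Cabs_lt_of_sq; lra.
        - intro c. subst w. unfold Cnorm2 in hw. simpl in hw. nra. }
      set (w1 := Cmul z (mkC al be)). set (w2 := Cmul z (mkC al (- be))).
      destruct (hroot w1) as [c1 [hc1 h1]].
      { transitivity (2 - 2 * al); [|unfold al; field]. unfold w1, Cnorm2. simpl.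
        ideal2 hz2 ((al - 1) * (al - 1) + be * be) hbe 1. }
      destruct (hroot w2) as [c2 [hc2 h2]].
      { transitivity (2 - 2 * al); [|unfold al; field]. unfold w2, Cnorm2. simpl.
        ideal2 hz2 ((al - 1) * (al - 1) + be * be) hbe 1. }
      exists (c1 * c2). split; [nra|]. intro u.
      (* [A - t = T* T - mu = - conj z U^-1 (U - w1) (U - w2)] *)
      assert (ef : A u -' t *' u = csc (Csub C0 (Cconj z)) (V (shift U w1 (shift U w2 u)))).
      { rewrite hA. apply ip_ext; intro x. simpl. hexpand.
        unfold w1, w2. simpl. replace t with (mu - m) by (unfold mu; ring).
        replace mu with (2 - 2 * al) by (unfold al; field). clearbody al be.
        ideal2 hz2 ((1 - 2 * al) * ip u x + (al * al + be * be) * (cre z * ip (V u) x + cim z * ip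
          (hJ (V u)) x))
          hbe (cre z * ip (V u) x + cim z * ip (hJ (V u)) x). }
      rewrite ef, nrm_csc, (nrmV E U V UV ipUU).
      replace (Cabs (Csub C0 (Cconj z))) with 1.
      2:{ rewrite <- hz. unfold Cabs, Cnorm2. simpl. f_equal. ring. }
      rewrite Rmult_1_l. eapply Rle_trans; [|apply h1]. specialize (h2 u). nra. }
  (* With [phi = 0] the residuals are the vectors [y = T u]. Since [ip u (T* y) = |y|^2], expanding
     [|T* y - m u|^2 >= m^2 |u|^2] gives [|T* y|^2 >= 2 m |y|^2]. *)
  destruct (landweber E (shift U z) (shift V (Cconj z)) (1 + 1) (sqrt (2 * m))) as [K [hK hl]];
    auto; try lra.
  { apply sqrt_lt_R0. lra. }
  exists K. split; auto. intro u. destruct (hl hzero) with (u := u) as [l [h1 h2]].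
  - clear u. intro u. replace (shift U z u -' hzero) with (shift U z u) by hring.
    set (y := shift U z u).
    pose proof (nrm_pos E (shift V (Cconj z) y)). pose proof (nrm_pos E y).
    assert (hy : ip u (shift V (Cconj z) y) = ip y y) by (now rewrite <- hadj).
    specialize (hlow u). rewrite hA in hlow. fold y in hlow.
    assert (hk : m * m * ip u u <= ip (shift V (Cconj z) y -' m *' u) (shift V (Cconj z) y -' m *'
      u)).
    { rewrite <- !nrm_sq. pose proof (nrm_pos E u). assert (0 <= m * nrm u) by nra. nra. }
    rewrite ip_subl, !ip_subr, !ip_scl, !ip_scr in hk.
    rewrite (ip_sym E (shift V _ y) u), hy in hk.
    apply Rsqr_incr_0_var; [|lra]. unfold Rsqr.
    replace (sqrt (2 * m) * nrm y * (sqrt (2 * m) * nrm y)) with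
       (sqrt (2 * m) * sqrt (2 * m) * (nrm y * nrm y)) by ring.
    rewrite sqrt_sqrt, !nrm_sq by lra. lra.
  - exists l. split; auto. rewrite nrm_sub_sym.
    replace (shift U z u -' hzero) with (shift U z u) in h2 by hring. exact h2.
Qed.

(** Split [|u|^2 = <u, u - k> + <u, k>] with [k] the nearby kernel element. The first term is
    controlled by [T_z u], a small perturbation of [T_w u]. The second is controlled by [T_w u]
    alone, since [k] also lies in the kernel of the adjoint and is thus orthogonal to the range of
    [T_z]. *)
Lemma ker_bound_isolated z : Cabs z = 1 -> ker_bound (shift U z) ->
  exists eps, 0 < eps /\ forall w, Cabs (Csub w z) < eps -> w <> z -> bounded_below U w.
Proof.
  intros hz [K [hK hg]].
  assert (hKi : 0 < / (2 * (K + 1))) by (apply Rinv_0_lt_compat; lra).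
  (* Within this radius [K d <= 1/2], so the error [K d |u|] can be absorbed on the left. *)
  exists (/ (2 * (K + 1))). split; auto. intros w hw hne.
  set (d := Cabs (Csub w z)) in *.
  assert (hd : 0 < d) by now apply Cabs_sub_pos.
  assert (hKd : K * d <= 1 / 2).
  { apply Rmult_lt_compat_l with (r := 2 * (K + 1)) in hw; [|lra].
    rewrite Rinv_r in hw by lra. nra. }
  set (L := 2 * (K + (1 + 2 * K) / d)).
  assert (h12 : 0 < (1 + 2 * K) / d) by (apply Rdiv_lt_0_compat; lra).
  assert (hL : 0 < L) by (unfold L; lra).
  exists (/ L). split; [now apply Rinv_0_lt_compat|]. intro u.
  destruct (hg u) as [k [hk hu]].
  pose proof (nrm_pos E u) as hu0. pose proof (nrm_pos E (shift U w u)) as hw0.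
  assert (hTz : nrm (shift U z u) <= nrm (shift U w u) + d * nrm u).
  { rewrite (shift_change E U w z). eapply Rle_trans; [apply nrm_sub|].
    rewrite nrm_csc, Cabs_sub_sym. fold d. lra. }
  assert (hTz2 : nrm (shift U z u) <= 2 * nrm u).
  { pose proof (shift_bounded E U ipUU z u) as hb. rewrite hz in hb. lra. }
  assert (hkn : nrm k <= (1 + 2 * K) * nrm u).
  { pose proof (nrm_le_sub E k u) as h. rewrite nrm_sub_sym in h. nra. }
  assert (hker : shift V (Cconj z) k = hzero).
  { apply nrm_zero_eq. rewrite (nrm_shiftV E U V UV VU ipUU) by exact hz. rewrite hk, nrm_zero.
    lra. }
  (* [(w - z) u = T_z u - T_w u] and [T_z u] is orthogonal to [k]. *)
  assert (hort : d * d * ip u k <= nrm (shift U w u) * (d * nrm k)).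
  { assert (e1 : d * d * ip u k = ip (csc (Csub w z) u) (csc (Csub w z) k)).
    { unfold d. rewrite Cabs_sq. unfold Cnorm2. hexpand.
      rewrite (ip_Jl E u k), ip_Jr. simpl. ring. }
    assert (e2 : csc (Csub w z) u = shift U z u -' shift U w u).
    { rewrite (shift_change E U z w). hring. }
    rewrite e1, e2, ip_subl.
    assert (e3 : ip (shift U z u) (csc (Csub w z) k) = 0).
    { rewrite (shift_adj E U V UV ipUU), cl_csc, hker. hexpand. ring. }
    rewrite e3. pose proof (abs_ip_le_nrm E (shift U w u) (csc (Csub w z) k)) as h.
    rewrite nrm_csc in h. fold d in h.
    pose proof (Rle_abs (- ip (shift U w u) (csc (Csub w z) k))) as h'. rewrite Rabs_Ropp in h'.
    lra. }
  assert (hort2 : ip u k <= nrm (shift U w u) * ((1 + 2 * K) / d) * nrm u).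
  { apply Rmult_le_reg_l with (d * d); [nra|]. eapply Rle_trans; [exact hort|].
    replace (d * d * (nrm (shift U w u) * ((1 + 2 * K) / d) * nrm u))
      with (nrm (shift U w u) * (d * ((1 + 2 * K) * nrm u))) by (field; lra).
    apply Rmult_le_compat_l; auto. nra. }
  assert (hmain : nrm u * nrm u <= nrm u * (K * (nrm (shift U w u) + d * nrm u)) +
     nrm (shift U w u) * ((1 + 2 * K) / d) * nrm u).
  { rewrite nrm_sq at 1. replace (ip u u) with (ip u (u -' k) + ip u k) by (hexpand; ring).
    pose proof (ip_le_nrm E u (u -' k)).
    assert (K * nrm (shift U z u) <= K * (nrm (shift U w u) + d * nrm u)) by nra.
    assert (nrm u * nrm (u -' k) <= nrm u * (K * (nrm (shift U w u) + d * nrm u))) by nra. lra. }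
  assert (hfin : nrm u <= L * nrm (shift U w u)).
  { destruct (Req_dec (nrm u) 0) as [z0|z0]; [rewrite z0; nra|].
    apply Rmult_le_reg_l with (nrm u); [lra|]. unfold L.
    set (q := (1 + 2 * K) / d) in *. nra. }
  apply Rmult_le_reg_l with L; [lra|]. rewrite <- Rmult_assoc, Rinv_r by lra. lra.
Qed.

Lemma ker_bound_eigenvector z : ker_bound (shift U z) -> ~ bounded_below U z ->
  exists k, shift U z k = hzero /\ k <> hzero.
Proof.
  intros [K [hK hg]] hn. apply NNPP. intro hc. apply hn.
  exists (/ (K + 1)). split; [apply Rinv_0_lt_compat; lra|]. intro u.
  destruct (hg u) as [k [hk hu]].
  assert (hk0 : k = hzero) by (apply NNPP; intro; apply hc; exists k; auto).
  subst k. replace (u -' hzero) with u in hu by hring.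
  pose proof (nrm_pos E (shift U z u)).
  apply Rmult_le_reg_l with (K + 1); [lra|]. rewrite <- Rmult_assoc, Rinv_r by lra. lra.
Qed.

End Unitary.

(** * The Hilbert space of square-summable sequences *)

Lemma psum_S f n : psum f (S n) = psum f n + f (Z.of_nat (S n)) + f (- Z.of_nat (S n))%Z.
Proof. reflexivity. Qed.

Lemma psum_0 f : psum f 0 = f 0%Z.
Proof. reflexivity. Qed.

Lemma psum_ext (f g : Z -> R) N : (forall x, f x = g x) -> psum f N = psum g N.
Proof. intro h. induction N as [|N IH]; simpl; rewrite ?IH, ?h; reflexivity. Qed.

Lemma psum_plus (f g : Z -> R) N : psum (fun x => f x + g x) N = psum f N + psum g N.
Proof. induction N as [|N IH]; rewrite ?psum_S, ?psum_0; [|rewrite IH]; ring. Qed.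

Lemma psum_scal r (f : Z -> R) N : psum (fun x => r * f x) N = r * psum f N.
Proof. induction N as [|N IH]; rewrite ?psum_S, ?psum_0; [|rewrite IH]; ring. Qed.

Lemma psum_le (f g : Z -> R) N : (forall x, f x <= g x) -> psum f N <= psum g N.
Proof.
  intro h. induction N as [|N IH]; rewrite ?psum_S, ?psum_0; [apply h|].
  pose proof (h (Z.of_nat (S N))). pose proof (h (- Z.of_nat (S N))%Z). lra.
Qed.

Lemma psum_const0 N : psum (fun _ => 0) N = 0.
Proof. induction N as [|N IH]; rewrite ?psum_S, ?psum_0; lra. Qed.

Lemma psum_nonneg (f : Z -> R) N : (forall x, 0 <= f x) -> 0 <= psum f N.
Proof. intro h. rewrite <- (psum_const0 N). now apply psum_le. Qed.

Lemma psum_growing (f : Z -> R) : (forall x, 0 <= f x) -> Un_growing (psum f).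
Proof.
  intros h n. rewrite psum_S. pose proof (h (Z.of_nat (S n))).
  pose proof (h (- Z.of_nat (S n))%Z). lra.
Qed.

Lemma psum_mono (f : Z -> R) n m : (forall x, 0 <= f x) -> (n <= m)%nat -> psum f n <= psum f m.
Proof. intros h k. apply Rge_le, growing_prop; [now apply psum_growing|lia]. Qed.

Lemma psum_ge_term (f : Z -> R) x : (forall x, 0 <= f x) -> f x <= psum f (Z.abs_nat x).
Proof.
  intro h. destruct (Z.abs_nat x) as [|n] eqn:e.
  - replace x with 0%Z by lia. simpl. lra.
  - rewrite ?psum_S, ?psum_0. pose proof (psum_nonneg f n h). pose proof (h (Z.of_nat (S n))).
    pose proof (h (- Z.of_nat (S n))%Z).
    destruct (Z.le_gt_cases 0 x) as [c|c].
    + replace (Z.of_nat (S n)) with x in * by lia. lra.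
    + replace (- Z.of_nat (S n))%Z with x in * by lia. lra.
Qed.

Lemma Un_cv_ext (a b : nat -> R) l : (forall n, a n = b n) -> Un_cv a l -> Un_cv b l.
Proof. intros h k e he. destruct (k e he) as [N hN]. exists N. intros n hn. rewrite <- h. auto. Qed.

Lemma Un_cv_le (a : nat -> R) l M : Un_cv a l -> (exists N, forall n, (N <= n)%nat -> a n <= M) ->
  l <= M.
Proof.
  intros h [N hN]. apply le_epsilon. intros e he. destruct (h e he) as [N' hN'].
  specialize (hN' (Nat.max N N') ltac:(lia)). specialize (hN (Nat.max N N') ltac:(lia)).
  unfold R_dist in hN'. apply Rabs_def2 in hN'. lra.
Qed.

Lemma Un_cv_growing_le (a : nat -> R) l n : Un_growing a -> Un_cv a l -> a n <= l.
Proof. intros. now apply growing_ineq. Qed.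

Lemma Un_cv_const (l : R) : Un_cv (fun _ => l) l.
Proof. intros e he. exists 0%nat. intros. unfold R_dist. rewrite Rminus_diag, Rabs_R0. lra. Qed.

Lemma psum_cv (f : Z -> R) M : (forall x, 0 <= f x) -> (forall N, psum f N <= M) ->
  exists l, Un_cv (psum f) l.
Proof.
  intros h k. destruct (growing_cv (psum f)) as [l hl].
  - now apply psum_growing.
  - exists M. intros y [n ->]. apply k.
  - now exists l.
Qed.

Definition vdot (u v : vec) : R :=
  cre (fst u) * cre (fst v) + cim (fst u) * cim (fst v) +
  cre (snd u) * cre (snd v) + cim (snd u) * cim (snd v).

Ltac vec_unfold := unfold vdot, vnorm2, vadd, vsub, vscale, vzero, Cnorm2, Cadd, Csub, Cmul,
  Cconj, RtoC, C0 in *; simpl fst in *; simpl snd in *; simpl cre in *; simpl cim in *.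

Lemma Cplx_eq (z w : Cplx) : cre z = cre w -> cim z = cim w -> z = w.
Proof. destruct z, w; simpl; congruence. Qed.

Lemma vec_eq (u v : vec) : cre (fst u) = cre (fst v) -> cim (fst u) = cim (fst v) ->
  cre (snd u) = cre (snd v) -> cim (snd u) = cim (snd v) -> u = v.
Proof. destruct u as [[] []], v as [[] []]; simpl; congruence. Qed.

Ltac vec_ring := apply vec_eq; vec_unfold; ring.

Lemma vnorm2_pos v : 0 <= vnorm2 v.
Proof. vec_unfold. nra. Qed.

Lemma vnorm2_coord v :
  cre (fst v) * cre (fst v) <= vnorm2 v /\ cim (fst v) * cim (fst v) <= vnorm2 v /\
  cre (snd v) * cre (snd v) <= vnorm2 v /\ cim (snd v) * cim (snd v) <= vnorm2 v.
Proof.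
  destruct v as [[a b] [c d]]. unfold vnorm2, Cnorm2; simpl.
  pose proof (Rle_0_sqr a). pose proof (Rle_0_sqr b). pose proof (Rle_0_sqr c).
  pose proof (Rle_0_sqr d).
  unfold Rsqr in *. repeat split; lra.
Qed.

Lemma vnorm2_vdot v : vnorm2 v = vdot v v.
Proof. vec_unfold. ring. Qed.

Lemma vnorm2_zero v : vnorm2 v <= 0 -> v = vzero.
Proof.
  intro h. apply vec_eq; vec_unfold; apply Rsqr_0_uniq; unfold Rsqr; nra.
Qed.

Lemma vnorm2_add u v : vnorm2 (vadd u v) <= 2 * vnorm2 u + 2 * vnorm2 v.
Proof.
  assert (h : vnorm2 (vadd u v) = 2 * vnorm2 u + 2 * vnorm2 v - vnorm2 (vsub u v)) by (vec_unfold;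
    ring).
  pose proof (vnorm2_pos (vsub u v)). lra.
Qed.

Lemma vnorm2_scale z v : vnorm2 (vscale z v) = Cnorm2 z * vnorm2 v.
Proof. vec_unfold. ring. Qed.

Definition ell : Type := {psi : H | l2 psi}.
Definition ev (u : ell) : Z -> vec := proj1_sig u.
Coercion ev : ell >-> Funclass.

Lemma ell_eq (u v : ell) : (forall x, u x = v x) -> u = v.
Proof.
  destruct u as [u hu], v as [v hv]. simpl. intro h.
  assert (e : u = v) by now apply functional_extensionality.
  subst. f_equal. apply proof_irrelevance.
Qed.

Lemma l2_cv (psi : H) : l2 psi -> exists l, Un_cv (psum (fun x => vnorm2 (psi x))) l.
Proof. intros [M hM]. apply psum_cv with M; [intro; apply vnorm2_pos|exact hM]. Qed.

Lemma l2_add (psi phi : H) : l2 psi -> l2 phi -> l2 (fun x => vadd (psi x) (phi x)).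
Proof.
  intros [M hM] [M' hM']. exists (2 * M + 2 * M'). intro N. specialize (hM N). specialize (hM' N).
  unfold pnorm2 in *. eapply Rle_trans; [apply psum_le; intro; apply vnorm2_add|].
  rewrite psum_plus, !psum_scal. lra.
Qed.

Lemma l2_scale z (psi : H) : l2 psi -> l2 (fun x => vscale z (psi x)).
Proof.
  intros [M hM]. exists (Cnorm2 z * M). intro N. specialize (hM N). unfold pnorm2 in *.
  rewrite (psum_ext _ (fun x => Cnorm2 z * vnorm2 (psi x))) by (intro; apply vnorm2_scale).
  rewrite psum_scal. apply Rmult_le_compat_l; auto. apply Cnorm2_pos.
Qed.

Lemma l2_zero : l2 (fun _ => vzero).
Proof.
  exists 0. intro N. unfold pnorm2. rewrite (psum_ext _ (fun _ => 0)), psum_const0; [lra|].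
  intro. vec_unfold. ring.
Qed.

Definition ell_zero : ell := exist _ _ l2_zero.
Definition ell_add (u v : ell) : ell := exist _ _ (l2_add u v (proj2_sig u) (proj2_sig v)).
Definition ell_scale (z : Cplx) (u : ell) : ell := exist _ _ (l2_scale z u (proj2_sig u)).

Definition ell_ip (u v : ell) : R :=
  epsilon (inhabits 0) (fun l => Un_cv (psum (fun x => vdot (u x) (v x))) l).

(** The limit chosen in [ell_ip] exists by polarization: [4 vdot u v = |u + v|^2 - |u - v|^2], and
    both series on the right converge. *)
Lemma ell_ip_cv (u v : ell) : Un_cv (psum (fun x => vdot (u x) (v x))) (ell_ip u v).
Proof.
  unfold ell_ip. apply epsilon_spec.
  destruct (l2_cv _ (proj2_sig (ell_add u v))) as [l1 h1].
  destruct (l2_cv _ (proj2_sig (ell_add u (ell_scale (RtoC (-1)) v)))) as [l2 h2].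
  exists (/ 4 * (l1 - l2)). eapply Un_cv_ext.
  2:{ apply (CV_mult (fun _ => / 4)); [apply Un_cv_const|]. apply CV_minus; eassumption. }
  intro n. simpl.
  replace (psum (fun x => vnorm2 (vadd (u x) (v x))) n - psum (fun x => vnorm2 (vadd (u x) (vscale
    (RtoC (-1)) (v x)))) n)
    with (psum (fun x => 4 * vdot (u x) (v x)) n).
  - rewrite psum_scal. field.
  - rewrite (psum_ext (fun x => 4 * vdot (u x) (v x)) (fun x => vnorm2 (vadd (u x) (v x)) +
      (-1) * vnorm2 (vadd (u x) (vscale (RtoC (-1)) (v x))))).
    + rewrite psum_plus, psum_scal. ring.
    + intro. vec_unfold. ring.
Qed.

Lemma ell_ip_eq (u v : ell) l : Un_cv (psum (fun x => vdot (u x) (v x))) l -> ell_ip u v = l.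
Proof. intro h. eapply UL_sequence; [apply ell_ip_cv|exact h]. Qed.

Lemma ell_norm2_le (u : ell) M : norm2_le u M <-> ell_ip u u <= M.
Proof.
  pose proof (ell_ip_cv u u) as h. split.
  - intro k. apply (Un_cv_le _ _ M h). exists 0%nat. intros n _.
    rewrite (psum_ext _ (fun x => vnorm2 (u x))) by (intro; now rewrite vnorm2_vdot). apply k.
  - intros k N. eapply Rle_trans; [|exact k].
    unfold pnorm2. rewrite (psum_ext _ (fun x => vdot (u x) (u x))) by (intro; apply vnorm2_vdot).
    apply (Un_cv_growing_le _ _ N); auto. apply psum_growing.
    intro. rewrite <- vnorm2_vdot. apply vnorm2_pos.
Qed.

Lemma ell_vnorm2_le (u : ell) x : vnorm2 (u x) <= ell_ip u u.
Proof.
  assert (h : norm2_le u (ell_ip u u)) by (apply ell_norm2_le; lra).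
  eapply Rle_trans; [|apply (h (Z.abs_nat x))].
  apply (psum_ge_term (fun x => vnorm2 (u x))). intro. apply vnorm2_pos.
Qed.

Lemma psum_family_cv (f : nat -> Z -> R) (g : Z -> R) N :
  (forall x, Un_cv (fun m => f m x) (g x)) -> Un_cv (fun m => psum (f m) N) (psum g N).
Proof.
  intro h. induction N as [|N IH]; simpl; [apply h|].
  apply (CV_plus (fun m => psum (f m) N + f m _)); [apply CV_plus|]; auto.
Qed.

Lemma ell_complete (s : nat -> ell) :
  (forall eps, 0 < eps -> exists N, forall n m, (N <= n)%nat -> (N <= m)%nat ->
     ell_ip (ell_add (s n) (ell_scale (RtoC (-1)) (s m))) (ell_add (s n) (ell_scale (RtoC (-1)) (s
       m))) <= eps) ->
  exists l, forall eps, 0 < eps -> exists N, forall n, (N <= n)%nat ->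
     ell_ip (ell_add l (ell_scale (RtoC (-1)) (s n))) (ell_add l (ell_scale (RtoC (-1)) (s n))) <=
       eps.
Proof.
  intro h. set (df := fun u v : ell => ell_add u (ell_scale (RtoC (-1)) v)).
  assert (hc : forall c : vec -> R, (forall u v, (c u - c v) * (c u - c v) <= vnorm2 (vsub u v)) ->
    forall x, exists l, Un_cv (fun m => c (s m x)) l).
  { intros c hcc x. destruct (R_complete (fun m => c (s m x))) as [l hl]; [|now exists l].
    intros e he. destruct (h (e / 2 * (e / 2))) as [N hN]; [nra|]. exists N. intros n m hn hm.
    specialize (hN n m hn hm). pose proof (ell_vnorm2_le (df (s n) (s m)) x) as k.
    specialize (hcc (s n x) (s m x)).
    assert (e1 : vnorm2 (df (s n) (s m) x) = vnorm2 (vsub (s n x) (s m x))) by (simpl; vec_unfold;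
      ring).
    rewrite e1 in k. unfold df in k. unfold R_dist.
    assert (k2 : Rsqr (c (s n x) - c (s m x)) <= Rsqr (e / 2)) by (unfold Rsqr; lra).
    apply Rsqr_le_abs_0 in k2. rewrite (Rabs_right (e / 2)) in k2 by lra. lra. }
  assert (hl : exists l : H, forall x, Un_cv (fun m => cre (fst (s m x))) (cre (fst (l x))) /\
     Un_cv (fun m => cim (fst (s m x))) (cim (fst (l x))) /\
     Un_cv (fun m => cre (snd (s m x))) (cre (snd (l x))) /\
     Un_cv (fun m => cim (snd (s m x))) (cim (snd (l x)))).
  { apply (choice (fun x v => Un_cv (fun m => cre (fst (s m x))) (cre (fst v)) /\
     Un_cv (fun m => cim (fst (s m x))) (cim (fst v)) /\
     Un_cv (fun m => cre (snd (s m x))) (cre (snd v)) /\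
     Un_cv (fun m => cim (snd (s m x))) (cim (snd v)))). intro x.
    destruct (hc (fun v => cre (fst v))) with (x := x) as [a ha]; [intros;
      apply (vnorm2_coord (vsub _ _))|].
    destruct (hc (fun v => cim (fst v))) with (x := x) as [b hb]; [intros;
      apply (vnorm2_coord (vsub _ _))|].
    destruct (hc (fun v => cre (snd v))) with (x := x) as [c hc']; [intros;
      apply (vnorm2_coord (vsub _ _))|].
    destruct (hc (fun v => cim (snd v))) with (x := x) as [d hd]; [intros;
      apply (vnorm2_coord (vsub _ _))|].
    exists (mkC a b, mkC c d). auto. }
  destruct hl as [l hl].
  (* On each finite window, [m] goes to infinity in [s m - s n]; the resulting bound does not depend
     on the window. *)
  assert (hle : forall eps, 0 < eps -> exists N, forall n, (N <= n)%nat ->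
     norm2_le (fun x => vadd (l x) (vscale (RtoC (-1)) (s n x))) eps).
  { intros e he. destruct (h e he) as [N hN]. exists N. intros n hn M.
    apply (Un_cv_le (fun m => pnorm2 (df (s m) (s n)) M)).
    - apply (psum_family_cv (fun m x => vnorm2 (df (s m) (s n) x))). intro x.
      destruct (hl x) as [h1 [h2 [h3 h4]]].
      assert (hsq : forall (a : nat -> R) b k, Un_cv a b ->
        Un_cv (fun m => (a m + k) * (a m + k)) ((b + k) * (b + k))).
      { intros a b k hab. apply CV_mult; apply CV_plus; auto using Un_cv_const. }
      pose proof (CV_plus _ _ _ _ (CV_plus _ _ _ _ (hsq _ _ (- cre (fst (s n x))) h1) (hsq _ _ (-
        cim (fst (s n x))) h2))
        (CV_plus _ _ _ _ (hsq _ _ (- cre (snd (s n x))) h3) (hsq _ _ (- cim (snd (s n x))) h4)))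
          as hsum.
      eapply Un_cv_ext; [|match goal with |- Un_cv _ ?g => match type of hsum with Un_cv _ ?g' =>
         replace g with g'; [exact hsum|] end end].
      + intro m. simpl. vec_unfold. ring.
      + vec_unfold. ring.
    - exists N. intros m hm. apply ell_norm2_le. now apply hN. }
  assert (hl2 : l2 l).
  { destruct (hle 1 ltac:(lra)) as [N hN]. specialize (hN N (Nat.le_refl _)).
    pose proof (l2_add _ _ (ex_intro _ _ hN) (proj2_sig (s N))) as [M hM].
    exists M. intro n. specialize (hM n). unfold pnorm2 in *. erewrite psum_ext; [exact hM|].
    intro x. simpl. f_equal. fold (ev (s N)). vec_ring. }
  exists (exist _ l hl2). intros e he. destruct (hle e he) as [N hN]. exists N. intros n hn.
  apply ell_norm2_le. simpl. now apply hN.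
Qed.

Lemma ell_ip_sym (u v : ell) : ell_ip u v = ell_ip v u.
Proof.
  apply ell_ip_eq. eapply Un_cv_ext; [|apply ell_ip_cv]. intro. apply psum_ext. intro. vec_unfold.
  ring.
Qed.

Lemma ell_ip_zerol (v : ell) : ell_ip ell_zero v = 0.
Proof.
  apply ell_ip_eq. eapply Un_cv_ext; [|apply Un_cv_const]. intro n. rewrite <- (psum_const0 n).
  apply psum_ext. intro. simpl. vec_unfold. ring.
Qed.

Lemma ell_ip_addl (u v w : ell) : ell_ip (ell_add u v) w = ell_ip u w + ell_ip v w.
Proof.
  apply ell_ip_eq. eapply Un_cv_ext.
  2:{ apply CV_plus; apply ell_ip_cv. }
  intro n. simpl. rewrite <- psum_plus. apply psum_ext. intro. vec_unfold. ring.
Qed.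

Lemma ell_ip_scl r (u w : ell) : ell_ip (ell_scale (RtoC r) u) w = r * ell_ip u w.
Proof.
  apply ell_ip_eq. eapply Un_cv_ext.
  2:{ apply (CV_mult (fun _ => r)); [apply Un_cv_const|apply ell_ip_cv]. }
  intro n. simpl. rewrite <- psum_scal. apply psum_ext. intro. vec_unfold. ring.
Qed.

Lemma ell_ip_Jr (u v : ell) : ell_ip u (ell_scale (mkC 0 1) v) = - ell_ip (ell_scale (mkC 0 1) u) v.
Proof.
  apply ell_ip_eq. eapply Un_cv_ext.
  2:{ apply CV_opp. apply ell_ip_cv. }
  intro n. unfold opp_seq. replace (- psum (fun x => vdot (ell_scale (mkC 0 1) u x) (v x)) n) with
   ((-1) * psum (fun x => vdot (ell_scale (mkC 0 1) u x) (v x)) n) by ring.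
  rewrite <- psum_scal. apply psum_ext. intro. simpl. vec_unfold. ring.
Qed.

Lemma ell_ip_JJ (u v : ell) : ell_ip (ell_scale (mkC 0 1) (ell_scale (mkC 0 1) u)) v = - ell_ip u v.
Proof.
  apply ell_ip_eq. eapply Un_cv_ext.
  2:{ apply CV_opp. apply ell_ip_cv. }
  intro n. unfold opp_seq. replace (- psum (fun x => vdot (u x) (v x)) n) with
   ((-1) * psum (fun x => vdot (u x) (v x)) n) by ring.
  rewrite <- psum_scal. apply psum_ext. intro. simpl. vec_unfold. ring.
Qed.

Lemma ell_ip_pos (u : ell) : 0 <= ell_ip u u.
Proof.
  pose proof (ell_vnorm2_le u 0). pose proof (vnorm2_pos (u 0%Z)). lra.
Qed.

Lemma ell_ip_ext (u v : ell) : (forall w, ell_ip u w = ell_ip v w) -> u = v.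
Proof.
  intro h. set (d := ell_add u (ell_scale (RtoC (-1)) v)).
  assert (hd : ell_ip d d = 0).
  { replace 0 with (ell_ip u d + (-1) * ell_ip v d) by (rewrite h; ring).
    apply ell_ip_eq. eapply Un_cv_ext.
    2:{ apply CV_plus; [|apply (CV_mult (fun _ => -1)); [apply Un_cv_const|]]; apply ell_ip_cv. }
    intro n. cbv beta. rewrite <- psum_scal, <- psum_plus. apply psum_ext. intro. simpl.
    vec_unfold. ring. }
  apply ell_eq. intro x. pose proof (ell_vnorm2_le d x) as k. rewrite hd in k.
  apply vnorm2_zero in k. simpl in k.
  assert (e : vadd (vadd (u x) (vscale (RtoC (-1)) (v x))) (v x) = u x) by vec_ring.
  fold (ev u) (ev v) in k. rewrite k in e. rewrite <- e. vec_ring.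
Qed.

Canonical ell2 : Hilbert := {|
  hcar := ell; hzero := ell_zero; hadd := ell_add; hsc := fun r => ell_scale (RtoC r);
  hJ := ell_scale (mkC 0 1); ip := ell_ip; ip_sym := ell_ip_sym; ip_zerol := ell_ip_zerol;
  ip_addl := ell_ip_addl; ip_scl := ell_ip_scl; ip_Jr := ell_ip_Jr; ip_JJ := ell_ip_JJ;
  ip_pos := ell_ip_pos; ip_ext := ell_ip_ext; hcomplete := ell_complete |}.

Lemma ev_add (u v : ell) x : (u +' v : ell) x = vadd (u x) (v x).
Proof. reflexivity. Qed.

Lemma ev_sub (u v : ell) x : (u -' v : ell) x = vsub (u x) (v x).
Proof. change ((u -' v : ell) x) with (vadd (u x) (vscale (RtoC (-1)) (v x))). vec_ring. Qed.

Lemma ev_sc r (u : ell) x : (r *' u : ell) x = vscale (RtoC r) (u x).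
Proof. reflexivity. Qed.

Lemma ev_csc z (u : ell) x : (csc z u : ell) x = vscale z (u x).
Proof.
  change ((csc z u : ell) x) with
    (vadd (vscale (RtoC (cre z)) (u x)) (vscale (RtoC (cim z)) (vscale (mkC 0 1) (u x)))).
  vec_ring.
Qed.

Lemma ev_zero x : (hzero : ell) x = vzero.
Proof. reflexivity. Qed.

Lemma psum_shift_up (f : Z -> R) N :
  psum (fun x => f (x + 1)%Z) N = psum f N + f (Z.of_nat N + 1)%Z - f (- Z.of_nat N)%Z.
Proof.
  induction N as [|N IH]; rewrite ?psum_S, ?psum_0.
  - simpl. ring.
  - rewrite IH. replace (- Z.of_nat (S N) + 1)%Z with (- Z.of_nat N)%Z by lia.
    replace (Z.of_nat (S N)) with (Z.of_nat N + 1)%Z by lia. ring.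
Qed.

Lemma psum_shift_down (f : Z -> R) N :
  psum (fun x => f (x - 1)%Z) N = psum f N + f (- Z.of_nat N - 1)%Z - f (Z.of_nat N)%Z.
Proof.
  induction N as [|N IH]; rewrite ?psum_S, ?psum_0.
  - simpl. ring.
  - rewrite IH. replace (Z.of_nat (S N) - 1)%Z with (Z.of_nat N)%Z by lia.
    replace (- Z.of_nat (S N))%Z with (- Z.of_nat N - 1)%Z by lia. ring.
Qed.

(** The window [[-N, N]] moved by one site fits in the next window. An inequality is enough, because
    [norm2_le] bounds all partial sums at once. *)
Lemma psum_shift_up_le (f : Z -> R) N : (forall x, 0 <= f x) ->
  psum (fun x => f (x + 1)%Z) N <= psum f (S N).
Proof.
  intro h. rewrite psum_shift_up, psum_S. replace (Z.of_nat (S N)) with (Z.of_nat N + 1)%Z by lia.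
  pose proof (h (- Z.of_nat N)%Z). pose proof (h (- (Z.of_nat N + 1))%Z). lra.
Qed.

Lemma psum_shift_down_le (f : Z -> R) N : (forall x, 0 <= f x) ->
  psum (fun x => f (x - 1)%Z) N <= psum f (S N).
Proof.
  intro h. rewrite psum_shift_down, psum_S.
  replace (- Z.of_nat (S N))%Z with (- Z.of_nat N - 1)%Z by lia.
  pose proof (h (Z.of_nat N)%Z). pose proof (h (Z.of_nat (S N))%Z). lra.
Qed.

(** * Walks as unitary operators *)

(** Only a norm inequality is demanded, since partial sums over windows do not respect exact
    isometries. Equality comes back in [lift_isometry]: a contraction with a contractive left
    inverse preserves norms, hence inner products by polarization. *)
Record contraction := {
  ct :> H -> H;
  ct_norm : forall psi M, norm2_le psi M -> norm2_le (ct psi) M;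
  ct_add : forall psi phi x, ct (fun x => vadd (psi x) (phi x)) x = vadd (ct psi x) (ct phi x);
  ct_scale : forall z psi x, ct (fun x => vscale z (psi x)) x = vscale z (ct psi x) }.

Definition ct_comp (F G : contraction) : contraction.
Proof.
  refine {| ct := fun psi => F (G psi) |}.
  - intros. now apply ct_norm, ct_norm.
  - intros. rewrite <- ct_add. f_equal. apply functional_extensionality. intro. apply ct_add.
  - intros. rewrite <- ct_scale. f_equal. apply functional_extensionality. intro. apply ct_scale.
Defined.

Lemma ct_l2 (F : contraction) psi : l2 psi -> l2 (F psi).
Proof. intros [M h]. exists M. now apply ct_norm. Qed.

Definition lift (F : contraction) : clin ell2.
Proof.
  refine {| cl_fun := fun u : ell => (exist _ (F u) (ct_l2 F u (proj2_sig u)) : ell) |}.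
  - intros u v. apply ell_eq. intro x. apply (ct_add F).
  - intros r u. apply ell_eq. intro x. apply (ct_scale F).
  - intros u. apply ell_eq. intro x. apply (ct_scale F).
Defined.

Lemma lift_ip_le F (u : ell) : ip (lift F u) (lift F u) <= ip u u.
Proof.
  apply (ell_norm2_le (lift F u)). apply (ct_norm F). apply (ell_norm2_le u). apply Rle_refl.
Qed.

Lemma ell_norm2 (u : ell) M : norm2_le u M <-> ip u u <= M.
Proof. apply ell_norm2_le. Qed.

Lemma lift_isometry F G (u v : ell) : (forall w : ell, lift G (lift F w) = w) ->
  ip (lift F u) (lift F v) = ip u v.
Proof.
  intro h.
  assert (hn : forall w : ell, ip (lift F w) (lift F w) = ip w w).
  { intro w. apply Rle_antisym; [apply lift_ip_le|]. rewrite <- (h w) at 1 2. apply lift_ip_le. }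
  pose proof (hn (u +' v)) as k. autorewrite with hip in k. rewrite !hn in k.
  rewrite (ip_sym _ (lift F v) (lift F u)), (ip_sym _ v u) in k. lra.
Qed.

Opaque lift.

Section Resolvent.
Variables (T : op) (U V : clin ell2).
Hypothesis TU : forall u : ell, ev (U u) = T u.
Hypothesis UV : forall u, U (V u) = u.
Hypothesis VU : forall u, V (U u) = u.
Hypothesis ipUU : forall u v, ip (U u) (U v) = ip u v.

Lemma ev_shift z (u : ell) : ev (shift U z u) = op_shift T z u.
Proof.
  apply functional_extensionality. intro x. unfold op_shift. rewrite <- TU.
  change (shift U z u) with (U u -' csc z u). now rewrite ev_sub, ev_csc.
Qed.

Lemma in_resolvent_iff z : in_resolvent T z <-> bounded_below U z.
Proof.
  split.
  - intros [S [K [h1 [h2 _]]]].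
    assert (hK : forall u : ell, ip u u <= K * ip (shift U z u) (shift U z u)).
    { intro u. apply (ell_norm2 u). intro n.
      assert (k : norm2_le (S (op_shift T z u)) (K * ip (shift U z u) (shift U z u))).
      { rewrite <- ev_shift. apply h1; [apply (proj2_sig (shift U z u))|].
        apply (ell_norm2 (shift U z u)). lra. }
      specialize (k n). unfold pnorm2 in *. erewrite psum_ext; [exact k|].
      intro x. simpl. rewrite h2; auto. apply (proj2_sig u). }
    (* [K] bounds squared norms and its sign is unknown, hence [|K| + 1] under the root. *)
    set (d := sqrt (Rabs K + 1)).
    assert (hd : 0 < d) by (apply sqrt_lt_R0; pose proof (Rabs_pos K); lra).
    assert (hdd : d * d = Rabs K + 1) by (apply sqrt_sqrt; pose proof (Rabs_pos K); lra).
    exists (/ d). split; [now apply Rinv_0_lt_compat|]. intro u.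
    apply Rmult_le_reg_l with d; [lra|]. rewrite <- Rmult_assoc, Rinv_r, Rmult_1_l by lra.
    pose proof (nrm_pos _ (shift U z u)). apply nrm_le_of_sq; [nra|].
    replace (d * nrm (shift U z u) * (d * nrm (shift U z u))) with
      (d * d * (nrm (shift U z u) * nrm (shift U z u))) by ring.
    rewrite hdd, nrm_sq. pose proof (hK u) as k. pose proof (ip_pos _ (shift U z u)).
    pose proof (Rle_abs K).
    eapply Rle_trans; [exact k|]. apply Rmult_le_compat_r; lra.
  - intro hr. destruct (bounded_below_solve _ U V UV VU ipUU z hr) as [K [hK hs]].
    destruct hr as [c [hc hlow]].
    assert (hf : exists f : ell -> ell, forall phi : ell, shift U z (f phi) = phi /\
      nrm (f phi) <= K * nrm phi).
    { apply (choice (fun phi u : ell => shift U z u = phi /\ nrm u <= K * nrm phi)). exact hs. }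
    destruct hf as [f hf].
    (* An [op] acts on all sequences; outside [l2] the value [psi] is an arbitrary filler. *)
    exists (fun psi => match excluded_middle_informative (l2 psi) with
      left h => ev (f (exist _ psi h)) | right _ => psi end), (K * K).
    split; [|split].
    + intros psi M hl hM. destruct (excluded_middle_informative (l2 psi)) as [h|h];
        [|contradiction].
      apply (ell_norm2 (f (exist _ psi h))). destruct (hf (exist _ psi h)) as [_ k].
      apply nrm_sq_le in k. eapply Rle_trans; [exact k|].
      set (u := exist _ psi h : ell) in *.
      change (@nrm ell2 u) with (nrm u).
      replace (K * nrm u * (K * nrm u)) with (K * K * (nrm u * nrm u)) by ring.
      rewrite nrm_sq. apply Rmult_le_compat_l; [nra|]. now apply (ell_norm2 u).
    + intros psi hl x. set (u := exist _ psi hl : ell).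
      assert (e : op_shift T z psi = ev (shift U z u)) by (now rewrite ev_shift).
      rewrite e. destruct (excluded_middle_informative _) as [h|h].
      2:{ exfalso. apply h, (proj2_sig (shift U z u)). }
      set (v := exist _ (ev (shift U z u)) h : ell).
      assert (ev1 : v = shift U z u) by (apply ell_eq; reflexivity).
      destruct (hf v) as [k _]. change (ev (f v) x = psi x). rewrite ev1 in *.
      replace (f (shift U z u)) with u; [reflexivity|]. symmetry.
      apply (hsub_zero_eq ell2), nrm_zero_eq.
      assert (k2 : shift U z (f (shift U z u) -' u) = hzero) by (rewrite cl_sub, k; hring).
      pose proof (hlow (f (shift U z u) -' u)) as k3. rewrite k2, nrm_zero in k3.
      apply Rmult_le_reg_l with c; lra.
    + intros psi hl x. destruct (excluded_middle_informative _) as [h|h]; [|contradiction].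
      destruct (hf (exist _ psi h)) as [k _]. rewrite <- ev_shift, k. reflexivity.
Qed.

Lemma spectrum_iff z : spectrum T z <-> ~ bounded_below U z.
Proof. unfold spectrum. now rewrite in_resolvent_iff. Qed.

Lemma is_eigvec_ker z (u : ell) : is_eigvec T z u <-> shift U z u = hzero.
Proof.
  split.
  - intros [_ h]. apply ell_eq. intro x.
    rewrite ev_shift. unfold op_shift. rewrite h. change (ev hzero x) with vzero. vec_ring.
  - intro h. split; [apply (proj2_sig u)|]. intro x.
    assert (e : ev (shift U z u) x = vzero) by (now rewrite h).
    rewrite ev_shift in e. unfold op_shift in e.
    replace (T u x) with (vadd (vsub (T u x) (vscale z (u x))) (vscale z (u x))) by vec_ring.
    rewrite e. vec_ring.
Qed.

End Resolvent.

Definition coin_ok (a1 a2 : R) (b : Cplx) : Prop :=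
  a1 ^ 2 + Cnorm2 b = 1 /\ a2 ^ 2 + Cnorm2 b = 1 /\ Cmul b (RtoC (a1 + a2)) = C0.

Lemma coin_ok_re a1 a2 b : coin_ok a1 a2 b ->
  cre b * (a1 + a2) = 0 /\ cim b * (a1 + a2) = 0.
Proof.
  intros [_ [_ h]]. split; [apply (f_equal cre) in h|apply (f_equal cim) in h]; simpl in h; lra.
Qed.

Lemma coin_vnorm2 a1 a2 b psi x : coin_ok (a1 x) (a2 x) (b x) ->
  vnorm2 (coin a1 a2 b psi x) = vnorm2 (psi x).
Proof.
  intro h. destruct (coin_ok_re _ _ _ h) as [h3 h4]. destruct h as [h1 [h2 _]].
  unfold coin. destruct (psi x) as [[u1 u2] [v1 v2]]. unfold vnorm2, Cnorm2 in *. simpl in *.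
  set (r := cre (b x)) in *. set (i := cim (b x)) in *. set (a := a1 x) in *. set (c := a2 x) in *.
  transitivity ((a * (a * 1) + (r * (r * 1) + i * (i * 1))) * (u1 * u1 + u2 * u2) +
    (c * (c * 1) + (r * (r * 1) + i * (i * 1))) * (v1 * v1 + v2 * v2) +
    2 * (r * (a + c)) * (u1 * v1 + u2 * v2) + 2 * (i * (a + c)) * (u1 * v2 - u2 * v1)).
  - ring.
  - rewrite h1, h2, h3, h4. ring.
Qed.

Lemma coin_coin a1 a2 b psi x : coin_ok (a1 x) (a2 x) (b x) ->
  coin a1 a2 b (coin a1 a2 b psi) x = psi x.
Proof.
  intro h. destruct (coin_ok_re _ _ _ h) as [h3 h4]. destruct h as [h1 [h2 _]].
  unfold coin. destruct (psi x) as [[u1 u2] [v1 v2]]. unfold Cnorm2 in *.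
  set (r := cre (b x)) in *. set (i := cim (b x)) in *. set (a := a1 x) in *. set (c := a2 x) in *.
  apply vec_eq; simpl; fold r i.
  - transitivity ((a ^ 2 + (r ^ 2 + i ^ 2)) * u1 + (r * (a + c)) * v1 + (i * (a + c)) * v2);
      [ring|rewrite h1, h3, h4; ring].
  - transitivity ((a ^ 2 + (r ^ 2 + i ^ 2)) * u2 + (r * (a + c)) * v2 - (i * (a + c)) * v1);
      [ring|rewrite h1, h3, h4; ring].
  - transitivity ((c ^ 2 + (r ^ 2 + i ^ 2)) * v1 + (r * (a + c)) * u1 - (i * (a + c)) * u2);
      [ring|rewrite h2, h3, h4; ring].
  - transitivity ((c ^ 2 + (r ^ 2 + i ^ 2)) * v2 + (r * (a + c)) * u2 + (i * (a + c)) * u1);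
      [ring|rewrite h2, h3, h4; ring].
Qed.

Definition coin_ct (a1 a2 : Z -> R) (b : Z ->
  Cplx) (h : forall x, coin_ok (a1 x) (a2 x) (b x)) : contraction.
Proof.
  refine {| ct := coin a1 a2 b |}.
  - intros psi M k N. unfold pnorm2. erewrite psum_ext; [apply k|]. intro. now apply coin_vnorm2.
  - intros. unfold coin. vec_ring.
  - intros. unfold coin. vec_ring.
Defined.

(* [gamma = D^* G D] with [D = diag (1, L)] and the constant coin [G = [[p, q], [conj q, -p]]]. *)
Lemma gamma_norm p q psi M : p ^ 2 + Cnorm2 q = 1 -> norm2_le psi M -> norm2_le (gamma p q psi) M.
Proof.
  intros hpq h.
  set (D := fun x => (fst (psi x), snd (psi (x + 1)%Z)) : vec).
  set (G := coin (fun _ => p) (fun _ => - p) (fun _ => Cconj q) D).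
  assert (hD : norm2_le D M).
  { intro N. unfold pnorm2, D, vnorm2. simpl. rewrite psum_plus.
    eapply Rle_trans; [|apply (h (S N))]. unfold pnorm2, vnorm2. rewrite psum_plus.
    apply Rplus_le_compat.
    - apply psum_mono; [intro; apply Cnorm2_pos|lia].
    - apply (psum_shift_up_le (fun x => Cnorm2 (snd (psi x)))). intro; apply Cnorm2_pos. }
  assert (hG : norm2_le G M).
  { intro N. unfold pnorm2. erewrite psum_ext; [apply hD|]. intro. apply coin_vnorm2.
    unfold coin_ok, Cnorm2 in *. simpl in *. repeat split; try lra.
    apply Cplx_eq; simpl; ring. }
  intro N. unfold pnorm2. rewrite (psum_ext _ (fun x => Cnorm2 (fst (G x)) + Cnorm2 (snd (G (x -
    1)%Z)))).
  - rewrite psum_plus. eapply Rle_trans; [|apply (hG (S N))]. unfold pnorm2, vnorm2.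
    rewrite psum_plus.
    apply Rplus_le_compat.
    + apply psum_mono; [intro; apply Cnorm2_pos|lia].
    + apply (psum_shift_down_le (fun x => Cnorm2 (snd (G x)))). intro; apply Cnorm2_pos.
  - intro x. unfold G, D, coin, gamma, vnorm2, Cnorm2. simpl. replace (x - 1 + 1)%Z with x by lia.
    ring.
Qed.

Lemma gamma_gamma p q psi x : p ^ 2 + Cnorm2 q = 1 -> gamma p q (gamma p q psi) x = psi x.
Proof.
  intro h. unfold gamma. simpl. replace (x + 1 - 1)%Z with x by lia.
  replace (x - 1 + 1)%Z with x by lia.
  unfold Cnorm2 in h. destruct (psi x) as [[u1 u2] [v1 v2]]. apply vec_eq; simpl.
  - transitivity ((p ^ 2 + (cre q ^ 2 + cim q ^ 2)) * u1); [ring|rewrite h; ring].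
  - transitivity ((p ^ 2 + (cre q ^ 2 + cim q ^ 2)) * u2); [ring|rewrite h; ring].
  - transitivity ((p ^ 2 + (cre q ^ 2 + cim q ^ 2)) * v1); [ring|rewrite h; ring].
  - transitivity ((p ^ 2 + (cre q ^ 2 + cim q ^ 2)) * v2); [ring|rewrite h; ring].
Qed.

Definition gamma_ct p q (h : p ^ 2 + Cnorm2 q = 1) : contraction.
Proof.
  refine {| ct := gamma p q |}.
  - intros. now apply gamma_norm.
  - intros. unfold gamma. vec_ring.
  - intros. unfold gamma. vec_ring.
Defined.

Section Walk.
Variables (p : R) (q : Cplx) (a1 a2 : Z -> R) (b : Z -> Cplx).
Hypothesis hpq : p ^ 2 + Cnorm2 q = 1.
Hypothesis hC : forall x, coin_ok (a1 x) (a2 x) (b x).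

Definition gamma_op : clin ell2 := lift (gamma_ct p q hpq).
Definition coin_op : clin ell2 := lift (coin_ct a1 a2 b hC).
Definition walk : clin ell2 := lift (ct_comp (gamma_ct p q hpq) (coin_ct a1 a2 b hC)).
Definition walk_inv : clin ell2 := lift (ct_comp (coin_ct a1 a2 b hC) (gamma_ct p q hpq)).

Lemma ev_walk (u : ell) : ev (walk u) = susyqw p q a1 a2 b u.
Proof. reflexivity. Qed.

Lemma walkE (u : ell) : walk u = gamma_op (coin_op u).
Proof. apply ell_eq. reflexivity. Qed.

Lemma walk_invE (u : ell) : walk_inv u = coin_op (gamma_op u).
Proof. apply ell_eq. reflexivity. Qed.

Lemma gamma_opK (u : ell) : gamma_op (gamma_op u) = u.
Proof. apply ell_eq. intro x. now apply (gamma_gamma p q u). Qed.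

Lemma coin_opK (u : ell) : coin_op (coin_op u) = u.
Proof. apply ell_eq. intro x. now apply (coin_coin a1 a2 b u). Qed.

Lemma ip_gamma_op (u v : ell) : ip (gamma_op u) (gamma_op v) = ip u v.
Proof. apply lift_isometry with (gamma_ct p q hpq). exact gamma_opK. Qed.

Lemma ip_coin_op (u v : ell) : ip (coin_op u) (coin_op v) = ip u v.
Proof. apply lift_isometry with (coin_ct a1 a2 b hC). exact coin_opK. Qed.

Lemma walkK (u : ell) : walk (walk_inv u) = u.
Proof. now rewrite walkE, walk_invE, coin_opK, gamma_opK. Qed.

Lemma walk_invK (u : ell) : walk_inv (walk u) = u.
Proof. now rewrite walkE, walk_invE, gamma_opK, coin_opK. Qed.

Lemma ip_walk (u v : ell) : ip (walk u) (walk v) = ip u v.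
Proof. now rewrite !walkE, ip_gamma_op, ip_coin_op. Qed.

Lemma walk_spectrum z : spectrum (susyqw p q a1 a2 b) z <-> ~ bounded_below walk z.
Proof.
  apply spectrum_iff with walk_inv; [exact ev_walk|exact walkK|exact walk_invK|exact ip_walk].
Qed.

Lemma walk_spectrum_circle z : spectrum (susyqw p q a1 a2 b) z -> Cabs z = 1.
Proof.
  rewrite walk_spectrum. intro h. apply NNPP. intro k. apply h.
  apply bounded_below_off_circle; auto. exact ip_walk.
Qed.

End Walk.

(** * Constant coins *)

Lemma finite_support_norm (psi : H) N : (forall x, (Z.of_nat N < Z.abs x)%Z -> psi x = vzero) ->
  norm2_le psi (pnorm2 psi N).
Proof.
  intros h n.
  assert (hk : forall k, pnorm2 psi (N + k) = pnorm2 psi N).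
  { induction k as [|k IH]; [now rewrite Nat.add_0_r|].
    rewrite Nat.add_succ_r. unfold pnorm2 in *. rewrite psum_S, IH.
    rewrite (h (Z.of_nat (S (N + k)))), (h (- Z.of_nat (S (N + k)))%Z) by lia.
    vec_unfold. ring. }
  destruct (Nat.le_ge_cases n N) as [c|c].
  - apply psum_mono; auto. intro. apply vnorm2_pos.
  - replace n with (N + (n - N))%nat by lia. rewrite hk. lra.
Qed.

Lemma psum_point (a : Z) n : psum (fun x => if (x =? a)%Z then 1 else 0) n <= 1.
Proof.
  assert (h : psum (fun x => if (x =? a)%Z then 1 else 0) n =
    if (Z.abs a <=? Z.of_nat n)%Z then 1 else 0).
  { induction n as [|n IH]; rewrite ?psum_S, ?psum_0, ?IH.
    - destruct (Z.eqb_spec 0 a), (Z.leb_spec (Z.abs a) (Z.of_nat 0)); auto; lia.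
    - destruct (Z.eqb_spec (Z.of_nat (S n)) a), (Z.eqb_spec (- Z.of_nat (S n)) a),
        (Z.leb_spec (Z.abs a) (Z.of_nat n)), (Z.leb_spec (Z.abs a) (Z.of_nat (S n))); try lia; lra.
        }
  rewrite h. destruct (_ <=? _)%Z; lra.
Qed.

Definition left_ct : contraction.
Proof.
  refine {| ct := fun psi x => psi (x + 1)%Z |}; try reflexivity.
  intros psi M h N. eapply Rle_trans; [|apply (h (S N))]. unfold pnorm2.
  apply (psum_shift_up_le (fun x => vnorm2 (psi x))). intro. apply vnorm2_pos.
Defined.

Definition right_ct : contraction.
Proof.
  refine {| ct := fun psi x => psi (x - 1)%Z |}; try reflexivity.
  intros psi M h N. eapply Rle_trans; [|apply (h (S N))]. unfold pnorm2.
  apply (psum_shift_down_le (fun x => vnorm2 (psi x))). intro. apply vnorm2_pos.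
Defined.

Definition left_shift : clin ell2 := lift left_ct.
Definition right_shift : clin ell2 := lift right_ct.

Lemma right_shiftK (u : ell) : left_shift (right_shift u) = u.
Proof.
  apply ell_eq. intro x. change (u (x + 1 - 1)%Z = u x). f_equal. lia.
Qed.

Lemma left_shiftK (u : ell) : right_shift (left_shift u) = u.
Proof.
  apply ell_eq. intro x. change (u (x - 1 + 1)%Z = u x). f_equal. lia.
Qed.

Lemma nrm_left_shift (u : ell) : nrm (left_shift u) = nrm u.
Proof. unfold nrm. f_equal. apply lift_isometry with right_ct. exact left_shiftK. Qed.

Lemma nrm_right_shift (u : ell) : nrm (right_shift u) = nrm u.
Proof. unfold nrm. f_equal. apply lift_isometry with left_ct. exact right_shiftK. Qed.

Fixpoint Cpow (z : Cplx) (n : nat) : Cplx :=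
  match n with O => RtoC 1 | S n => Cmul z (Cpow z n) end.

Lemma Cnorm2_mul z w : Cnorm2 (Cmul z w) = Cnorm2 z * Cnorm2 w.
Proof. unfold Cnorm2. simpl. ring. Qed.

Lemma Cnorm2_pow z n : Cnorm2 z = 1 -> Cnorm2 (Cpow z n) = 1.
Proof.
  intro h. induction n as [|n IH]; simpl.
  - unfold Cnorm2. simpl. ring.
  - rewrite Cnorm2_mul, h, IH. ring.
Qed.

Lemma unit_with_real_part (be : Cplx) (s : R) : Rabs s <= Cabs be ->
  exists w, Cnorm2 w = 1 /\ cre (Cmul be w) = s.
Proof.
  intro h. pose proof (Cabs_sq be) as hs. pose proof (Cabs_pos be).
  destruct (Req_dec (Cabs be) 0) as [z|z].
  - exists (RtoC 1). split; [unfold Cnorm2; simpl; ring|].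
    assert (s0 : s = 0).
    { destruct (Req_dec s 0) as [|n]; auto. apply Rabs_pos_lt in n. lra. }
    rewrite z in hs. unfold Cnorm2 in hs. simpl. subst s.
    assert (cre be = 0) by (apply Rsqr_0_uniq; unfold Rsqr; nra). lra.
  - set (n := Cnorm2 be) in *. assert (hn : 0 < n) by nra.
    assert (hss : s * s <= n).
    { rewrite <- hs.
      assert (k : Rsqr s <= Rsqr (Cabs be)).
      { apply Rsqr_le_abs_1. rewrite (Rabs_right (Cabs be)); lra. }
      exact k. }
    set (t := sqrt (n - s * s)). assert (ht : t * t = n - s * s) by (apply sqrt_sqrt; lra).
    (* This is [(s + i t) / be], where [t] is chosen so that [s + i t] has the modulus of [be]. *)
    exists (Cmul (mkC (s / n) (t / n)) (Cconj be)). split.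
    + rewrite Cnorm2_mul.
      assert (e : Cnorm2 (Cconj be) = n) by (unfold n, Cnorm2; simpl; ring). rewrite e.
      unfold Cnorm2. simpl. replace (s / n * (s / n * 1) + t / n * (t / n * 1))
        with ((s * s + t * t) / (n * n)) by (field; lra).
      rewrite ht. field. lra.
    + transitivity (s / n * Cnorm2 be); [|fold n; field; lra]. clearbody n t. unfold Cnorm2. simpl.
      unfold Rdiv. ring.
Qed.

(** If [u] is an eigenvector of [L] for [w] up to a defect [d], then it is one of [R = L^-1] for
    [conj w] up to [- conj w R d]. Hence the hopping operator acts on [u] as its symbol
    [2 Re (be w)], up to terms in [d]. *)
Lemma hop_symbol (E : Hilbert) (L R : clin E) (be w : Cplx) (u d : E) :
  (forall u, R (L u) = u) -> Cnorm2 w = 1 -> L u = csc w u +' d ->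
  csc be (L u) +' csc (Cconj be) (R u) -' (2 * cre (Cmul be w)) *' u =
  csc be d -' csc (Cconj be) (csc (Cconj w) (R d)).
Proof.
  intros hRL hw hd.
  assert (e1 : R u = csc (Cconj w) u -' csc (Cconj w) (R d)).
  { assert (e2 : u = csc w (R u) +' R d) by (now rewrite <- cl_csc, <- cl_add, <- hd, hRL).
    rewrite e2 at 2. unfold Cnorm2 in hw. apply ip_ext; intro x. hexpand. simpl.
    pose proof (eq_refl 0) as e0. ideal2 hw (- ip (R u) x) e0 0. }
  rewrite e1, hd. hring.
Qed.

Lemma shift_involution (E : Hilbert) (U : clin E) z u : (forall u, U (U u) = u) ->
  shift U z (shift U (Csub C0 z) u) = csc (Csub (RtoC 1) (Cmul z z)) u.
Proof. intro h. apply ip_ext; intro x. simpl. hexpand. rewrite h. simpl. ring. Qed.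

(** * Truncated plane waves [w^x] in the first component *)

Section PlaneWave.
Variables (w : Cplx) (hw : Cnorm2 w = 1).

Definition wave_fun (N : nat) : H := fun x =>
  if ((0 <=? x) && (x <=? Z.of_nat N))%Z%bool then (Cpow w (Z.to_nat x), C0) else vzero.

Lemma wave_l2 N : l2 (wave_fun N).
Proof.
  exists (pnorm2 (wave_fun N) N). apply finite_support_norm. intros x hx. unfold wave_fun.
  destruct (Z.leb_spec 0 x), (Z.leb_spec x (Z.of_nat N)); simpl; auto. lia.
Qed.

Definition wave N : ell := exist _ _ (wave_l2 N).

Lemma wave_vnorm2 N x : (0 <= x <= Z.of_nat N)%Z -> vnorm2 (wave_fun N x) = 1.
Proof.
  intro h. unfold wave_fun. destruct (Z.leb_spec 0 x), (Z.leb_spec x (Z.of_nat N)); try lia. simpl.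
  unfold vnorm2. simpl. rewrite Cnorm2_pow by auto. unfold Cnorm2. simpl. ring.
Qed.

Lemma wave_norm N : INR N <= ip (wave N) (wave N).
Proof.
  assert (h : norm2_le (wave N) (ip (wave N) (wave N))) by (apply (ell_norm2 (wave N)), Rle_refl).
  eapply Rle_trans; [|apply (h N)].
  assert (k : forall n, (n <= N)%nat -> INR n <= pnorm2 (wave N) n).
  { unfold pnorm2. induction n as [|n IH]; intro hn.
    - apply psum_nonneg. intro. apply vnorm2_pos.
    - rewrite psum_S, S_INR. specialize (IH ltac:(lia)).
      change (wave N (Z.of_nat (S n))) with (wave_fun N (Z.of_nat (S n))).
      rewrite wave_vnorm2 by lia. pose proof (vnorm2_pos (wave N (- Z.of_nat (S n))%Z)). lra. }
  apply k. lia.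
Qed.

(** The wave equation fails only at the two edge sites [-1] and [N], by a vector of norm one at
    each. The defect stays bounded while the squared norm of the wave grows with [N]. *)
Lemma wave_defect N : ip (left_shift (wave N) -' csc w (wave N)) (left_shift (wave N) -' csc w
  (wave N)) <= 2.
Proof.
  apply (ell_norm2 (left_shift (wave N) -' csc w (wave N))). intro n.
  eapply Rle_trans with (psum (fun x => (if (x =? -1)%Z then 1 else 0) + (if (x =? Z.of_nat N)%Z
    then 1 else 0)) n).
  2:{ rewrite psum_plus. pose proof (psum_point (-1) n). pose proof (psum_point (Z.of_nat N) n).
      lra. }
  apply psum_le. intro x. rewrite ev_sub, ev_csc.
  change (ev (left_shift (wave N)) x) with (wave_fun N (x + 1)%Z).
  change (wave N x) with (wave_fun N x).
  destruct (Z.eqb_spec x (-1)) as [e1|e1].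
  - subst x. change (wave_fun N (-1)%Z) with vzero. change (-1 + 1)%Z with 0%Z.
    replace (vsub (wave_fun N 0%Z) (vscale w vzero)) with (wave_fun N 0%Z) by vec_ring.
    rewrite wave_vnorm2 by lia. destruct (_ =? _)%Z; lra.
  - destruct (Z.eqb_spec x (Z.of_nat N)) as [e2|e2].
    + subst x. unfold wave_fun at 1.
      replace ((0 <=? Z.of_nat N + 1) && (Z.of_nat N + 1 <=? Z.of_nat N))%Z%bool with false.
      2:{ destruct (Z.leb_spec 0 (Z.of_nat N + 1)), (Z.leb_spec (Z.of_nat N + 1) (Z.of_nat N));
            auto; lia. }
      replace (vsub vzero (vscale w (wave_fun N (Z.of_nat N)))) with
        (vscale (Csub C0 w) (wave_fun N (Z.of_nat N))) by vec_ring.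
      rewrite vnorm2_scale, wave_vnorm2 by lia.
      replace (Cnorm2 (Csub C0 w)) with (Cnorm2 w) by (unfold Cnorm2; simpl; ring). lra.
    + replace (vsub (wave_fun N (x + 1)%Z) (vscale w (wave_fun N x))) with vzero.
      * vec_unfold. lra.
      * unfold wave_fun. destruct (Z.leb_spec 0 x), (Z.leb_spec x (Z.of_nat N)),
          (Z.leb_spec 0 (x + 1)), (Z.leb_spec (x + 1) (Z.of_nat N)); try lia; simpl andb; cbv iota;
            try vec_ring.
        replace (Z.to_nat (x + 1)) with (S (Z.to_nat x)) by lia. simpl Cpow. vec_ring.
Qed.

End PlaneWave.

Section Symmetry.
Variables (p : R) (q : Cplx) (a1 a2 : Z -> R) (b : Z -> Cplx).
Hypothesis hpq : p ^ 2 + Cnorm2 q = 1.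
Hypothesis hC : forall x, coin_ok (a1 x) (a2 x) (b x).
Let U := walk p q a1 a2 b hpq hC.
Let V := walk_inv p q a1 a2 b hpq hC.

(* [Gamma U Gamma = U^-1] makes the spectrum symmetric under conjugation. *)
Lemma bounded_below_conj z : Cabs z = 1 -> bounded_below U (Cconj z) -> bounded_below U z.
Proof.
  intros hz [c [hc h]]. exists c. split; auto. intro u.
  specialize (h (gamma_op p q hpq u)).
  assert (hg : forall v : ell, nrm (gamma_op p q hpq v) = nrm v) by (intro; unfold nrm;
    now rewrite ip_gamma_op).
  assert (e : shift U (Cconj z) (gamma_op p q hpq u) = gamma_op p q hpq (shift V (Cconj z) u)).
  { rewrite !shiftE, cl_sub, cl_csc. unfold U, V. rewrite walkE, walk_invE. reflexivity. }
  rewrite e, !hg in h.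
  rewrite (nrm_shiftV ell2 U V) in h; auto.
  - apply walkK.
  - apply walk_invK.
  - apply ip_walk.
Qed.
End Symmetry.

Section ConstantCoin.
Variables (p : R) (q : Cplx) (a1 a2 : R) (b : Cplx).
Hypothesis hq : q <> C0.
Hypothesis hpq : p ^ 2 + Cnorm2 q = 1.
Hypothesis hC : coin_ok a1 a2 b.
Let U := walk p q (fun _ => a1) (fun _ => a2) (fun _ => b) hpq (fun _ => hC).
Let V := walk_inv p q (fun _ => a1) (fun _ => a2) (fun _ => b) hpq (fun _ => hC).

Lemma UVK (u : ell) : U (V u) = u.
Proof. apply walkK. Qed.
Lemma ipU (u v : ell) : ip (U u) (U v) = ip u v.
Proof. apply ip_walk. Qed.

Lemma nontrivial_a2 : ~ coin_trivial a1 a2 b -> a2 = - a1.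
Proof.
  intro hn. destruct (coin_ok_re _ _ _ hC) as [h3 h4]. pose proof hC as [h1 [h2 _]].
  destruct (Req_dec (a1 + a2) 0) as [e|e]; [lra|]. exfalso. apply hn.
  assert (hr : cre b = 0) by (apply Rmult_integral in h3; tauto).
  assert (hi : cim b = 0) by (apply Rmult_integral in h4; tauto).
  unfold Cnorm2 in *. rewrite hr, hi in *. split; [now apply Cplx_eq|].
  assert (k1 : (a1 - 1) * (a1 + 1) = 0) by lra.
  assert (k2 : (a2 - 1) * (a2 + 1) = 0) by lra.
  apply Rmult_integral in k1. apply Rmult_integral in k2.
  destruct k1, k2; [left|exfalso|exfalso|right]; try split; lra.
Qed.

Lemma bounded_below_of_product z z' c : Cabs z = 1 -> Cabs z' = 1 -> 0 < c ->
  (forall u : ell, c * nrm u <= nrm (shift U z (shift U z' u))) -> bounded_below U z.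
Proof.
  intros hz hz' hc h. exists (c / 2). split; [lra|]. intro u. specialize (h u).
  rewrite shift_comm in h. pose proof (shift_bounded ell2 U ipU z' (shift U z u)) as k.
  rewrite hz' in k. lra.
Qed.

Section Band.
Hypothesis ha2 : a2 = - a1.

(** [U + U^-1 = Gamma C + C Gamma]. Because [a2 = - a1], the off-diagonal blocks cancel and the
    diagonal ones agree, so the operator acts identically on both components and scalar plane waves
    suffice. *)
Lemma anticommutator (u : ell) :
  U u +' V u = (2 * (p * a1)) *' u +' csc (Cmul q b) (left_shift u) +' csc (Cconj (Cmul q b))
    (right_shift u).
Proof.
  apply ell_eq. intro x. rewrite !ev_add, !ev_csc, ev_sc.
  change (ev (U u) x) with (susyqw p q (fun _ => a1) (fun _ => a2) (fun _ => b) u x).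
  change (ev (V u) x) with (coin (fun _ => a1) (fun _ => a2) (fun _ => b) (gamma p q u) x).
  change (ev (left_shift u) x) with (u (x + 1)%Z). change (ev (right_shift u) x) with (u (x - 1)%Z).
  unfold susyqw, gamma, coin. subst a2. vec_ring.
Qed.

Lemma product_formula z (u : ell) : Cabs z = 1 ->
  nrm (shift U z (shift U (Cconj z) u)) =
  nrm ((2 * (p * a1 - cre z)) *' u +' csc (Cmul q b) (left_shift u) +' csc (Cconj (Cmul q b))
    (right_shift u)).
Proof.
  intro hz. rewrite (shift_shift ell2 U V UVK).
  - rewrite (nrmU ell2 U ipU), anticommutator. f_equal. simpl cre. hring.
  - apply Cabs_eq_1 in hz. unfold Cnorm2 in hz. apply Cplx_eq; simpl; lra.
  - reflexivity.
Qed.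

Lemma bounded_below_outside_band z : Cabs z = 1 -> Cabs (Cmul q b) < Rabs (p * a1 - cre z) ->
  bounded_below U z.
Proof.
  intros hz hlt. apply (bounded_below_of_product z (Cconj z) (2 * (Rabs (p * a1 - cre z) - Cabs
    (Cmul q b)))); auto.
  - now rewrite Cabs_conj.
  - lra.
  - intro u. rewrite product_formula by auto.
    set (A := csc (Cmul q b) (left_shift u)). set (B := csc (Cconj (Cmul q b)) (right_shift u)).
    set (D := (2 * (p * a1 - cre z)) *' u).
    assert (hA : nrm A = Cabs (Cmul q b) * nrm u) by (unfold A; rewrite nrm_csc, nrm_left_shift;
      reflexivity).
    assert (hB : nrm B = Cabs (Cmul q b) * nrm u) by (unfold B;
      rewrite nrm_csc, nrm_right_shift, Cabs_conj; reflexivity).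
    assert (hD : nrm D = 2 * Rabs (p * a1 - cre z) * nrm u).
    { unfold D. rewrite nrm_sc, Rabs_mult, (Rabs_right 2) by lra. reflexivity. }
    pose proof (nrm_sub _ (D +' A +' B) B) as h1.
    replace (D +' A +' B -' B) with (D +' A) in h1 by hring.
    pose proof (nrm_sub _ (D +' A) A) as h2. replace (D +' A -' A) with D in h2 by hring. lra.
Qed.

(** Plane waves show only that [(U - z) (U - conj z)] is not bounded below, so that [z] or [conj z]
    is in the spectrum. The conjugation symmetry settles which: both are. *)
Lemma not_bounded_below_in_band z : Cabs z = 1 -> Rabs (cre z - p * a1) <= Cabs (Cmul q b) ->
  ~ bounded_below U z.
Proof.
  intros hz hle hr.
  assert (hr2 : bounded_below U (Cconj z)).
  { apply bounded_below_conj; [now rewrite Cabs_conj|]. replace (Cconj (Cconj z)) with z; auto.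
    apply Cplx_eq; simpl; ring. }
  destruct hr as [c1 [hc1 h1]]. destruct hr2 as [c2 [hc2 h2]].
  destruct (unit_with_real_part _ _ hle) as [w [hw hre]].
  set (B := Cabs (Cmul q b)) in *. assert (hB : 0 <= B) by apply Cabs_pos.
  (* By the choice of [w] the symbol vanishes and only the two defect terms remain, each of norm at
     most [2 B]. *)
  assert (hall : forall N, c1 * c2 * nrm (wave w N) <= 4 * B).
  { intro N. set (u := wave w N). set (d := left_shift u -' csc w u).
    assert (hd : nrm d <= 2).
    { apply nrm_le_of_sq; [lra|]. pose proof (wave_defect w hw N) as k. fold u d in k. lra. }
    eapply Rle_trans with (nrm (shift U z (shift U (Cconj z) u))).
    { eapply Rle_trans; [|apply h1]. specialize (h2 u). nra. }
    rewrite product_formula by auto.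
    assert (e1 : left_shift u = csc w u +' d) by (unfold d; hring).
    replace ((2 * (p * a1 - cre z)) *' u +' csc (Cmul q b) (left_shift u) +' csc (Cconj (Cmul q b))
      (right_shift u))
      with (csc (Cmul q b) d -' csc (Cconj (Cmul q b)) (csc (Cconj w) (right_shift d))).
    2:{ rewrite <- hop_symbol with (L := left_shift) (u := u) (w := w);
          [|exact left_shiftK|exact hw|exact e1].
        rewrite hre. clearbody u d. apply ip_ext; intro x. hexpand. ring. }
    eapply Rle_trans; [apply nrm_sub|].
    rewrite !nrm_csc, nrm_right_shift, !Cabs_conj, (Cnorm2_eq_1 w hw).
    fold B. nra. }
  set (M := 4 * B / (c1 * c2)).
  assert (hc : 0 < c1 * c2) by nra.
  assert (hM : forall N, INR N <= M * M).
  { intro N. eapply Rle_trans; [apply (wave_norm w hw)|]. apply nrm_sq_le.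
    apply Rmult_le_reg_l with (c1 * c2); auto. specialize (hall N). unfold M.
    replace (c1 * c2 * (4 * B / (c1 * c2))) with (4 * B) by (field; lra). exact hall. }
  destruct (INR_unbounded (M * M)) as [N hN]. specialize (hM N). lra.
Qed.

End Band.

Section Trivial.
Variable s : R.
Hypothesis hs : s = 1 \/ s = -1.
Hypothesis hb : b = C0.
Hypothesis hs1 : a1 = s.
Hypothesis hs2 : a2 = s.

Lemma trivial_involution (u : ell) : U (U u) = u.
Proof.
  assert (h : forall v : ell, U v = s *' gamma_op p q hpq v).
  { intro v. unfold U. rewrite walkE. apply ell_eq. intro x. rewrite ev_sc.
    change (gamma p q (coin (fun _ => a1) (fun _ => a2) (fun _ => b) v) x = vscale (RtoC s) (gamma
      p q v x)).
    unfold gamma, coin. rewrite hb, hs1, hs2. vec_ring. }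
  rewrite !h, cl_sc, gamma_opK. apply ip_ext; intro. hexpand. destruct hs as [e|e]; rewrite e; ring.
Qed.

Lemma trivial_band z : Cabs z = 1 -> (~ bounded_below U z <-> (cre z = 1 \/ cre z = -1)).
Proof.
  intro hz. pose proof (Cabs_eq_1 z hz) as hz2. unfold Cnorm2 in hz2. split.
  - intro hn. apply NNPP. intro hc. apply hn.
    set (m := Csub C0 z).
    assert (hm : Cabs m = 1) by (rewrite <- hz; unfold Cabs, Cnorm2; simpl; f_equal; ring).
    set (k := Csub (RtoC 1) (Cmul z z)).
    apply (bounded_below_of_product z m (Cabs k) hz hm).
    + apply Cabs_sub_pos. intro e. pose proof (f_equal cre e) as e1. simpl in e1.
      apply hc. assert (h : (cre z - 1) * (cre z + 1) = 0) by nra.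
      apply Rmult_integral in h. destruct h; [left|right]; lra.
    + intro u. rewrite <- nrm_csc. right. f_equal. symmetry. apply shift_involution.
      exact trivial_involution.
  - intros h [c [hc hr]].
    assert (hzi : cim z = 0).
    { apply Rsqr_0_uniq. unfold Rsqr. destruct h as [e|e]; rewrite e in hz2; lra. }
    (* [dl] is the first basis vector at site 0. Since [U^2 = 1 = z^2], the vector [v = (U + z) dl]
       is killed by [U - z]. It is not zero, because its second component at site 1 is
       [s conj q]. *)
    set (dl := wave (RtoC 1) 0).
    set (v := shift U (Csub C0 z) dl).
    assert (hv : shift U z v = hzero).
    { unfold v. rewrite shift_involution by exact trivial_involution.
      replace (Csub (RtoC 1) (Cmul z z)) with C0; [hring|].
      apply Cplx_eq; simpl; rewrite hzi; destruct h as [e|e]; rewrite e; ring. }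
    specialize (hr v). rewrite hv, nrm_zero in hr.
    assert (hv0 : v = hzero).
    { apply nrm_zero_eq. apply Rmult_le_reg_l with c; lra. }
    assert (k : ev v 1%Z = vzero) by (now rewrite hv0).
    unfold v in k. rewrite shiftE, ev_sub, ev_csc in k.
    change (ev (U dl) 1%Z) with (susyqw p q (fun _ => a1) (fun _ => a2) (fun _ => b) dl 1%Z) in k.
    unfold susyqw, gamma, coin in k.
    change (dl (1 - 1)%Z) with ((RtoC 1, C0) : vec) in k.
    change (dl 1%Z) with vzero in k.
    rewrite hb, hs1, hs2 in k. apply (f_equal snd) in k. simpl in k.
    pose proof (f_equal cre k) as k1. pose proof (f_equal cim k) as k2. simpl in k1, k2.
    apply hq. apply Cplx_eq; simpl; destruct hs as [e|e]; rewrite e in *; lra.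
Qed.

End Trivial.

Lemma constant_spectrum z :
  spectrum (susyqw p q (fun _ => a1) (fun _ => a2) (fun _ => b)) z <->
  Cabs z = 1 /\ in_band p q a1 a2 b (cre z).
Proof.
  split.
  - intro h. pose proof (walk_spectrum_circle _ _ _ _ _ hpq (fun _ => hC) _ h) as hz.
    split; auto. rewrite (walk_spectrum _ _ _ _ _ hpq (fun _ => hC)) in h. fold U in h.
    destruct (classic (coin_trivial a1 a2 b)) as [t|t].
    + left. split; auto. destruct t as [tb [[t1 t2]|[t1 t2]]].
      * now apply (trivial_band 1 ltac:(auto) tb t1 t2).
      * now apply (trivial_band (-1) ltac:(auto) tb t1 t2).
    + right. split; auto.
      assert (k : Rabs (p * a1 - cre z) <= Cabs (Cmul q b)).
      { apply Rnot_lt_le. intro c. apply h. apply bounded_below_outside_band; auto.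
        now apply nontrivial_a2. }
      unfold Rabs in k. destruct (Rcase_abs _); lra.
  - intros [hz hb]. rewrite (walk_spectrum _ _ _ _ _ hpq (fun _ => hC)). fold U.
    destruct hb as [[t hb]|[t hb]].
    + destruct t as [tb [[t1 t2]|[t1 t2]]].
      * now apply (trivial_band 1 ltac:(auto) tb t1 t2).
      * now apply (trivial_band (-1) ltac:(auto) tb t1 t2).
    + apply not_bounded_below_in_band; auto; [now apply nontrivial_a2|]. apply Rabs_le. lra.
Qed.

End ConstantCoin.

(** * The essential spectrum *)

Lemma psum_ext_in (f g : Z -> R) N :
  (forall x, (Z.abs x <= Z.of_nat N)%Z -> f x = g x) -> psum f N = psum g N.
Proof.
  induction N as [|N IH]; intro h; rewrite ?psum_S, ?psum_0.
  - apply h. lia.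
  - rewrite IH, !h by (try intros; try apply h; lia). reflexivity.
Qed.

Lemma psum_single (f : Z -> R) a N : (forall x, x <> a -> f x = 0) -> (Z.abs a <= Z.of_nat N)%Z ->
  psum f N = f a.
Proof.
  intros h. induction N as [|N IH]; intro hN; rewrite ?psum_S, ?psum_0.
  - f_equal. lia.
  - destruct (Z.le_gt_cases (Z.abs a) (Z.of_nat N)) as [c|c].
    + rewrite IH, (h (Z.of_nat (S N))), (h (- Z.of_nat (S N))%Z) by lia. ring.
    + rewrite (psum_ext_in f (fun _ => 0)) by (intros; apply h; lia). rewrite psum_const0.
      destruct (Z.le_gt_cases 0 a) as [d|d].
      * rewrite (h (- Z.of_nat (S N))%Z) by lia. replace (Z.of_nat (S N)) with a by lia. ring.
      * rewrite (h (Z.of_nat (S N))) by lia. replace (- Z.of_nat (S N))%Z with a by lia. ring.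
Qed.

(** * Supports, truncations and finite-dimensional constraints *)

Lemma ip_disjoint (u v : ell) : (forall x, u x = vzero \/ v x = vzero) -> ip u v = 0.
Proof.
  intro h. apply ell_ip_eq. eapply Un_cv_ext; [|apply Un_cv_const]. intro n.
  rewrite <- (psum_const0 n). apply psum_ext. intro x.
  destruct (h x) as [e|e]; rewrite e; vec_unfold; ring.
Qed.

Lemma nrm_le_pointwise (u v : ell) K : 0 <= K ->
  (forall x, vnorm2 (u x) <= K * K * vnorm2 (v x)) -> nrm u <= K * nrm v.
Proof.
  intros hK h. pose proof (nrm_pos _ v). apply nrm_le_of_sq; [nra|].
  replace (K * nrm v * (K * nrm v)) with (K * K * (nrm v * nrm v)) by ring. rewrite nrm_sq.
  apply (ell_norm2 u). intro n. unfold pnorm2. eapply Rle_trans; [apply psum_le; exact h|].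
  rewrite psum_scal. apply Rmult_le_compat_l; [nra|].
  apply (ell_norm2 v); apply Rle_refl.
Qed.

Definition cut_ct (S : Z -> bool) : contraction.
Proof.
  refine {| ct := fun psi x => if S x then psi x else vzero |}.
  - intros psi M h N. eapply Rle_trans; [|apply (h N)]. apply psum_le. intro x.
    destruct (S x); [lra|]. pose proof (vnorm2_pos (psi x)). vec_unfold. lra.
  - intros. destruct (S x); [reflexivity|vec_ring].
  - intros. destruct (S x); [reflexivity|vec_ring].
Defined.

Definition cut (S : Z -> bool) : clin ell2 := lift (cut_ct S).

Lemma ev_cut S (u : ell) x : ev (cut S u) x = if S x then u x else vzero.
Proof. reflexivity. Qed.

Lemma delta_l2 a v : l2 (fun x => if (x =? a)%Z then v else vzero).
Proof.
  eexists. apply finite_support_norm with (N := Z.abs_nat a). intros x hx.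
  destruct (Z.eqb_spec x a); auto. lia.
Qed.

Definition delta a v : ell := exist _ _ (delta_l2 a v).

Lemma ip_delta (u : ell) a v : ip u (delta a v) = vdot (u a) v.
Proof.
  apply ell_ip_eq. intros e he. exists (Z.abs_nat a). intros n hn.
  rewrite (psum_single _ a).
  - simpl. rewrite Z.eqb_refl. unfold R_dist. rewrite Rminus_diag, Rabs_R0. exact he.
  - intros x hx. simpl. destruct (Z.eqb_spec x a); [contradiction|]. vec_unfold. ring.
  - lia.
Qed.

Definition zrange (N : nat) : list Z :=
  map Z.of_nat (seq 0 (S N)) ++ map (fun n => (- Z.of_nat n)%Z) (seq 0 (S N)).

Lemma in_zrange N x : (Z.abs x <= Z.of_nat N)%Z -> In x (zrange N).
Proof.
  intro h. unfold zrange. apply in_or_app. destruct (Z.le_gt_cases 0 x) as [c|c].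
  - left. apply in_map_iff. exists (Z.to_nat x). split; [lia|]. apply in_seq. lia.
  - right. apply in_map_iff. exists (Z.to_nat (- x)). split; [lia|]. apply in_seq. lia.
Qed.

(** A real basis of the fibre over [x]: orthogonality for [ip] is a real condition, so the multiples
    by [i] have to be listed too. *)
Definition site_basis (x : Z) : list ell :=
  delta x (RtoC 1, C0) :: delta x (mkC 0 1, C0) :: delta x (C0, RtoC 1) :: delta x (C0, mkC 0 1) ::
    nil.

Definition box_basis (N : nat) : list ell := flat_map site_basis (zrange N).

Lemma box_basis_orthogonal N (u : ell) : Forall (fun e => ip u e = 0) (box_basis N) ->
  forall x, (Z.abs x <= Z.of_nat N)%Z -> u x = vzero.
Proof.
  intros h x hx. rewrite Forall_forall in h.
  assert (k : forall e, In e (site_basis x) -> ip u e = 0).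
  { intros e he. apply h. apply in_flat_map. exists x. split; auto. now apply in_zrange. }
  pose proof (k _ (or_introl eq_refl)) as k1.
  pose proof (k _ (or_intror (or_introl eq_refl))) as k2.
  pose proof (k _ (or_intror (or_intror (or_introl eq_refl)))) as k3.
  pose proof (k _ (or_intror (or_intror (or_intror (or_introl eq_refl))))) as k4.
  rewrite ip_delta in k1, k2, k3, k4. apply vec_eq; vec_unfold; lra.
Qed.

Definition box (M : nat) (x : Z) : bool := (Z.abs x <=? Z.of_nat M)%Z.

Lemma cut_box_close (v : ell) d : 0 < d -> exists M, nrm (v -' cut (box M) v) <= d.
Proof.
  intro hd. pose proof (ell_ip_cv v v) as hcv.
  assert (hcv2 : Un_cv (psum (fun x => vnorm2 (v x))) (ell_ip v v)).
  { eapply Un_cv_ext; [|exact hcv]. intro. apply psum_ext. intro. now rewrite vnorm2_vdot. }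
  destruct (hcv2 (d * d)) as [M hM]; [nra|]. exists M. specialize (hM M (Nat.le_refl _)).
  unfold R_dist in hM. apply Rabs_def2 in hM.
  apply nrm_le_of_sq; [lra|]. set (w := v -' cut (box M) v).
  assert (hw : forall x, ev w x = if box M x then vzero else v x).
  { intro x. unfold w. rewrite ev_sub, ev_cut. destruct (box M x); vec_ring. }
  assert (h0 : pnorm2 (ev w) M = 0).
  { unfold pnorm2. rewrite (psum_ext_in _ (fun _ => 0)), psum_const0; auto. intros x hx.
    rewrite hw. unfold box. destruct (Z.leb_spec (Z.abs x) (Z.of_nat M)); [|lia]. vec_unfold. ring.
    }
  assert (hk : forall k, pnorm2 (ev w) (M + k) = psum (fun x => vnorm2 (v x)) (M + k) - psum (fun x
    => vnorm2 (v x)) M).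
  { induction k as [|k IH]; [rewrite Nat.add_0_r, h0; ring|]. rewrite Nat.add_succ_r.
    unfold pnorm2 in *. rewrite !psum_S, IH, !hw. unfold box.
    destruct (Z.leb_spec (Z.abs (Z.of_nat (S (M + k)))) (Z.of_nat M)); [lia|].
    destruct (Z.leb_spec (Z.abs (- Z.of_nat (S (M + k)))) (Z.of_nat M)); [lia|]. ring. }
  assert (hle : forall n, psum (fun x => vnorm2 (v x)) n <= ell_ip v v).
  { intro n. apply Un_cv_growing_le; auto. apply psum_growing. intro. apply vnorm2_pos. }
  apply (ell_norm2 w). intro n. destruct (Nat.le_ge_cases n M) as [c|c].
  - eapply Rle_trans; [apply (psum_mono (fun x => vnorm2 (ev w x)) n M)|]; auto.
    + intro. apply vnorm2_pos.
    + fold (pnorm2 (ev w) M). rewrite h0. nra.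
  - replace n with (M + (n - M))%nat by lia. rewrite hk. specialize (hle (M + (n - M))%nat). lra.
Qed.

Lemma ell_nonzero (u : ell) : u <> hzero -> exists x, u x <> vzero.
Proof.
  intro h. apply NNPP. intro c. apply h. apply ell_eq. intro x. rewrite ev_zero.
  apply NNPP. intro k. apply c. now exists x.
Qed.

Lemma rcomb_lincomb (cs : list R) (vs : list ell) x :
  ev (rcomb cs vs : ell) x = lincomb (map RtoC cs) (map ev vs) x.
Proof.
  revert vs. induction cs as [|c cs IH]; intros [|v vs]; try reflexivity.
  change (rcomb (c :: cs) (v :: vs)) with (c *' v +' rcomb cs vs). rewrite ev_add, IH. reflexivity.
Qed.

Lemma ell_list (vs : list H) : Forall l2 vs -> exists ws : list ell, map ev ws = vs.
Proof.
  induction 1 as [|v vs h _ [ws IH]].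
  - now exists nil.
  - exists (exist _ v h :: ws). simpl. now rewrite IH.
Qed.

(** The coefficients are complex whereas [ip] sees only real parts, hence the additional
    orthogonality to the vectors [hJ w]. *)
Lemma ip_lincomb (u k : ell) : forall cs (ws : list ell), heq k (lincomb cs (map ev ws)) ->
  Forall (fun w => ip u w = 0) ws -> Forall (fun w => ip u (hJ w) = 0) ws -> ip u k = 0.
Proof.
  intros cs. revert k. induction cs as [|c cs IH]; intros k [|w ws] hk h1 h2.
  - rewrite ip_sym. apply ip_disjoint. intro x. left. apply hk.
  - rewrite ip_sym. apply ip_disjoint. intro x. left. apply hk.
  - rewrite ip_sym. apply ip_disjoint. intro x. left. apply hk.
  - inversion h1; inversion h2; subst.
    replace k with (csc c w +' (k -' csc c w)) by hring. rewrite ip_addr.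
    rewrite (IH (k -' csc c w) ws); auto.
    + rewrite ip_cscr. rewrite ip_Jr in *.
      match goal with hh : - ip (hJ u) w = 0, h : ip u w = 0 |- _ => rewrite h; nra end.
    + intro x. rewrite ev_sub, ev_csc, hk. unfold lincomb. simpl. vec_ring.
Qed.

Section Walk.
Variables (p : R) (q : Cplx) (a1 a2 : Z -> R) (b : Z -> Cplx).
Hypothesis hpq : p ^ 2 + Cnorm2 q = 1.
Hypothesis hC : forall x, coin_ok (a1 x) (a2 x) (b x).
Let T := susyqw p q a1 a2 b.
Let U := walk p q a1 a2 b hpq hC.
Let V := walk_inv p q a1 a2 b hpq hC.
Let UV : forall u, U (V u) = u := walkK p q a1 a2 b hpq hC.
Let VU : forall u, V (U u) = u := walk_invK p q a1 a2 b hpq hC.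
Let ipU : forall u v, ip (U u) (U v) = ip u v := ip_walk p q a1 a2 b hpq hC.
Let spec_res : forall z, spectrum T z <-> ~ bounded_below U z := walk_spectrum p q a1 a2 b hpq hC.

Lemma disc_of_ker_bound z : ker_bound (shift U z) -> Cabs z = 1 -> ~ bounded_below U z ->
  (exists es : list ell, forall u : ell, shift U z u = hzero -> Forall (fun e => ip u e = 0) es ->
    u = hzero) ->
  disc_spectrum T z.
Proof.
  intros hg hz hn [es hes]. split; [now apply spec_res|]. split.
  - destruct (ker_bound_isolated ell2 U V UV VU ipU z hz hg) as [eps [he h]].
    exists eps. split; auto. intros w hw hwe. apply NNPP. intro c. apply spec_res in hw. apply hw.
    now apply h.
  - split.
    + destruct (ker_bound_eigenvector ell2 U z hg hn) as [k [h1 h2]]. exists (ev k). split.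
      * apply (is_eigvec_ker T U (ev_walk p q a1 a2 b hpq hC)). exact h1.
      * now apply ell_nonzero.
    (* The hypothesis on [es] bounds the real dimension of the kernel; a real spanning family also
       spans with complex coefficients. *)
    + destruct (finite_span ell2 es (fun u => shift U z u = hzero)) as [vs hvs]; auto.
      { intros r u v hu hv. rewrite cl_add, cl_sc, hu, hv. hring. }
      exists (map ev vs). split.
      * apply Forall_forall. intros v hv. apply in_map_iff in hv. destruct hv as [w [<- _]].
        apply (proj2_sig w).
      * intros psi hpsi. destruct hpsi as [hl hp] eqn:hh. set (u := exist _ psi hl : ell).
        destruct (hvs u) as [cs [h1 h2]].
        { apply (is_eigvec_ker T U (ev_walk p q a1 a2 b hpq hC)). exact hpsi. }
        exists (map RtoC cs). split; [now rewrite !length_map|]. intro x.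
        rewrite <- rcomb_lincomb. change (psi x) with (ev u x). now rewrite h2 at 1.
Qed.

(** [sing eta n] stands for the [eta]-approximate eigenvectors that live beyond [n]; the last
    hypothesis lets vectors with well separated supports be combined. *)
Lemma not_disc_of_singular z (sing : R -> nat -> ell -> Prop) : Cabs z = 1 ->
  (forall eta n, 0 < eta -> exists u, sing eta n u) ->
  (forall eta n u, 0 < eta -> sing eta n u -> 0 < nrm u /\ nrm (shift U z u) <= eta * nrm u) ->
  (forall eta n u, 0 < eta -> sing eta n u -> exists n', forall u', sing eta n' u' ->
     forall a b, (a <> 0 \/ b <> 0) -> sing eta n (a *' u +' b *' u')) ->
  ~ disc_spectrum T z.
Proof.
  intros hz h1 h2 h3 [_ [[eps [he hiso]] [_ [vs [hl2 hvs]]]]].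
  destruct (isolated_ker_bound ell2 U V UV VU ipU z eps hz he) as [K [hK hg]].
  { intros w hw hne. apply NNPP. intro c. apply hne. apply hiso; auto. now apply spec_res. }
  destruct (ell_list vs hl2) as [ws <-].
  (* So that [K eta < 1]: a nonzero [u] orthogonal to the kernel would satisfy
     [|u| <= K |T u| <= K eta |u| < |u|]. *)
  set (eta := / (2 * (K + 1))). assert (heta : 0 < eta) by (apply Rinv_0_lt_compat; lra).
  assert (hKe : K * eta < 1).
  { apply Rmult_lt_reg_r with (2 * (K + 1)); [lra|]. unfold eta.
    rewrite Rmult_assoc, Rinv_l by lra. lra. }
  destruct (orthogonal_choice ell2 (sing eta) (ws ++ map hJ ws)) with (n := 0%nat) as [u [hu ho]];
    auto.
  apply Forall_app in ho. destruct ho as [ho1 ho2]. apply Forall_map in ho2.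
  destruct (h2 _ _ _ heta hu) as [hu0 hTu].
  assert (hb : nrm u <= K * nrm (shift U z u)).
  { apply ker_bound_orthogonal; auto. intros k hk.
    destruct (hvs (ev k)) as [cs [_ hcs]].
    { apply (is_eigvec_ker T U (ev_walk p q a1 a2 b hpq hC)). exact hk. }
    now apply (ip_lincomb u k cs ws). }
  nra.
Qed.

Lemma shift_local z (u : ell) x : u (x - 1)%Z = vzero -> u x = vzero -> u (x + 1)%Z = vzero ->
  ev (shift U z u) x = vzero.
Proof.
  intros h1 h2 h3. rewrite shiftE, ev_sub, ev_csc, h2.
  change (ev (U u) x) with (gamma p q (coin a1 a2 b u) x). unfold gamma, coin. rewrite h1, h2, h3.
  vec_ring.
Qed.

(** [U - z] enlarges supports by one site on each side, so vectors whose supports are more than two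
    sites apart have orthogonal images. *)
Lemma nrm_disjoint z (u v : ell) (al be : R) : (forall x y, (Z.abs (x - y) <= 2)%Z ->
  u x = vzero \/ v y = vzero) ->
  ip (al *' u +' be *' v) (al *' u +' be *' v) = al * al * ip u u + be * be * ip v v /\
  ip (shift U z (al *' u +' be *' v)) (shift U z (al *' u +' be *' v)) =
    al * al * ip (shift U z u) (shift U z u) + be * be * ip (shift U z v) (shift U z v).
Proof.
  intro h.
  assert (e1 : ip u v = 0).
  { apply ip_disjoint. intro x. apply h. lia. }
  assert (e2 : ip (shift U z u) (shift U z v) = 0).
  { apply ip_disjoint. intro x.
    destruct (classic (u (x - 1)%Z = vzero /\ u x = vzero /\
      u (x + 1)%Z = vzero)) as [[k1 [k2 k3]]|k].
    - left. now apply shift_local.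
    - right. apply NNPP. intro c. apply k.
      assert (hy : exists y, (Z.abs (x - y) <= 1)%Z /\ v y <> vzero).
      { apply NNPP. intro c2. apply c. apply shift_local; apply NNPP; intro c3; apply c2; eexists;
          split; try exact c3; lia. }
      destruct hy as [y [hy1 hy2]].
      repeat split; match goal with |- ev u ?t = _ => destruct (h t y ltac:(lia)); tauto end. }
  rewrite cl_add, !cl_sc. hexpand.
  rewrite (ip_sym _ v u), (ip_sym _ (shift U z v) (shift U z u)), e1, e2. split; ring.
Qed.

(** * One end of the line: [sg = 1] is the right end, [sg = -1] the left one *)

Section Side.
Variables (sg : Z) (c1 c2 : R) (d : Cplx).
Hypothesis hsg : (sg = 1 \/ sg = -1)%Z.
Hypothesis hlim : forall eps, 0 < eps -> exists n : nat, forall x, (Z.of_nat n <= sg * x)%Z ->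
  Rabs (a1 x - c1) < eps /\ Rabs (a2 x - c2) < eps /\ Cabs (Csub (b x) d) < eps.

Lemma limit_coin_ok : coin_ok c1 c2 d.
Proof.
  assert (hcv : forall (f : Z -> R) l,
    (forall eps, 0 < eps -> exists n : nat, forall x, (Z.of_nat n <= sg * x)%Z ->
      Rabs (f x - l) < eps) ->
    Un_cv (fun n => f (sg * Z.of_nat n)%Z) l).
  { intros f l h e he. destruct (h e he) as [n hn]. exists n. intros m hm. apply hn.
    destruct hsg; subst; lia. }
  assert (hcomp : forall z e, Cabs z < e -> Rabs (cre z) < e /\ Rabs (cim z) < e).
  { intros z e h. pose proof (Cabs_sq z) as k. unfold Cnorm2 in k. pose proof (Cabs_pos z).
    split; (eapply Rle_lt_trans; [|exact h]); rewrite <- (Rabs_right (Cabs z)) by lra;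
      apply Rsqr_le_abs_0; unfold Rsqr; nra. }
  assert (k1 : Un_cv (fun n => a1 (sg * Z.of_nat n)%Z) c1).
  { apply hcv. intros e he. destruct (hlim e he) as [n hn]. exists n. intros x hx. now apply hn. }
  assert (k2 : Un_cv (fun n => a2 (sg * Z.of_nat n)%Z) c2).
  { apply hcv. intros e he. destruct (hlim e he) as [n hn]. exists n. intros x hx. now apply hn. }
  assert (k3 : Un_cv (fun n => cre (b (sg * Z.of_nat n)%Z)) (cre d)).
  { apply (hcv (fun x => cre (b x))). intros e he. destruct (hlim e he) as [n hn]. exists n.
    intros x hx.
    apply (hcomp (Csub (b x) d)). now apply hn. }
  assert (k4 : Un_cv (fun n => cim (b (sg * Z.of_nat n)%Z)) (cim d)).
  { apply (hcv (fun x => cim (b x))). intros e he. destruct (hlim e he) as [n hn]. exists n.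
    intros x hx.
    apply (hcomp (Csub (b x) d)). now apply hn. }
  assert (hu : forall (f : nat -> R) l m, Un_cv f l -> (forall n, f n = m) -> l = m).
  { intros f l m h1 h2. eapply UL_sequence; [exact h1|]. eapply Un_cv_ext; [|apply Un_cv_const].
    intro. now rewrite h2. }
  pose proof (CV_plus _ _ _ _ (CV_mult _ _ _ _ k3 k3) (CV_mult _ _ _ _ k4 k4)) as kb.
  unfold coin_ok, Cnorm2. split; [|split].
  - apply (hu (fun n => a1 (sg * Z.of_nat n)%Z * a1 (sg * Z.of_nat n)%Z + (cre (b (sg * Z.of_nat
      n)%Z) * cre (b (sg * Z.of_nat n)%Z) + cim (b (sg * Z.of_nat n)%Z) * cim (b (sg * Z.of_nat
        n)%Z)))).
    + replace (c1 ^ 2 + (cre d ^ 2 + cim d ^ 2))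
        with (c1 * c1 + (cre d * cre d + cim d * cim d)) by ring.
      apply (CV_plus _ _ _ _ (CV_mult _ _ _ _ k1 k1) kb).
    + intro n. destruct (hC (sg * Z.of_nat n)%Z) as [h _]. unfold Cnorm2 in h. lra.
  - apply (hu (fun n => a2 (sg * Z.of_nat n)%Z * a2 (sg * Z.of_nat n)%Z + (cre (b (sg * Z.of_nat
      n)%Z) * cre (b (sg * Z.of_nat n)%Z) + cim (b (sg * Z.of_nat n)%Z) * cim (b (sg * Z.of_nat
        n)%Z)))).
    + replace (c2 ^ 2 + (cre d ^ 2 + cim d ^ 2))
        with (c2 * c2 + (cre d * cre d + cim d * cim d)) by ring.
      apply (CV_plus _ _ _ _ (CV_mult _ _ _ _ k2 k2) kb).
    + intro n. destruct (hC (sg * Z.of_nat n)%Z) as [_ [h _]]. unfold Cnorm2 in h. lra.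
  - apply Cplx_eq; simpl.
    + transitivity (cre d * (c1 + c2)); [ring|].
      apply (hu _ _ _ (CV_mult _ _ _ _ k3 (CV_plus _ _ _ _ k1 k2))). intro n.
      apply (coin_ok_re _ _ _ (hC (sg * Z.of_nat n)%Z)).
    + transitivity (cim d * (c1 + c2)); [ring|].
      apply (hu _ _ _ (CV_mult _ _ _ _ k4 (CV_plus _ _ _ _ k1 k2))). intro n.
      apply (coin_ok_re _ _ _ (hC (sg * Z.of_nat n)%Z)).
Qed.

Let Us := walk p q (fun _ => c1) (fun _ => c2) (fun _ => d) hpq (fun _ => limit_coin_ok).

Lemma asymptotic_closeness z eps : 0 < eps -> exists n : nat, forall u : ell,
  (forall x, (sg * x < Z.of_nat n)%Z -> u x = vzero) ->
  nrm (shift U z u -' shift Us z u) <= eps * nrm u.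
Proof.
  (* Four entries smaller than [eps / 2] give a two by two matrix of norm at most [eps]; [Gamma] is
     isometric and does not change the estimate. *)
  intro he. destruct (hlim (eps / 2) ltac:(lra)) as [n hn]. exists n. intros u hu.
  set (A := coin_op a1 a2 b hC u).
  set (B := coin_op (fun _ => c1) (fun _ => c2) (fun _ => d) (fun _ => limit_coin_ok) u).
  assert (e : shift U z u -' shift Us z u = gamma_op p q hpq (A -' B)).
  { rewrite !shiftE. unfold U, Us. rewrite !walkE, cl_sub. fold A B. hring. }
  rewrite e. replace (nrm (gamma_op p q hpq (A -' B))) with (nrm (A -' B)) by (unfold nrm;
    now rewrite ip_gamma_op).
  apply nrm_le_pointwise; [lra|]. intro x. rewrite ev_sub.
  change (ev A x) with (coin a1 a2 b u x).
  change (ev B x) with (coin (fun _ => c1) (fun _ => c2) (fun _ => d) u x).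
  unfold coin. destruct (Z.lt_ge_cases (sg * x) (Z.of_nat n)) as [c|c].
  { rewrite (hu x c). vec_unfold. nra. }
  destruct (hn x c) as [h1 [h2 h3]]. destruct (u x) as [[u1 u2] [v1 v2]].
  assert (sq : forall t e, 0 <= e -> Rabs t < e -> t * t <= e * e).
  { intros t e0 he0 ht. assert (k : Rsqr t <= Rsqr e0) by (apply Rsqr_le_abs_1;
      rewrite (Rabs_right e0); lra). exact k. }
  apply sq in h1; [|lra]. apply sq in h2; [|lra].
  assert (h4 : Cnorm2 (Csub (b x) d) <= eps / 2 * (eps / 2)).
  { rewrite <- Cabs_sq. pose proof (Cabs_pos (Csub (b x) d)). nra. }
  set (al := a1 x - c1) in *. set (ga := a2 x - c2) in *. unfold Cnorm2 in h4. simpl in h4.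
  set (r := cre (b x) - cre d) in *. set (i := cim (b x) - cim d) in *.
  unfold vnorm2, Cnorm2. simpl.
  apply Rle_trans with (2 * (al * al * (u1 * u1 + u2 * u2) + (r * r + i * i) * (v1 * v1 + v2 * v2))
    +
     2 * ((r * r + i * i) * (u1 * u1 + u2 * u2) + ga * ga * (v1 * v1 + v2 * v2))).
  - assert (par : forall s t, (s + t) * (s + t) <= 2 * (s * s) + 2 * (t * t)) by (intros s t;
      pose proof (Rle_0_sqr (s - t)); unfold Rsqr in *; lra).
    pose proof (par (al * u1) (r * v1 + i * v2)) as p1.
    pose proof (par (al * u2) (r * v2 - i * v1)) as p2.
    pose proof (par (r * u1 - i * u2) (ga * v1)) as p3.
    pose proof (par (r * u2 + i * u1) (ga * v2)) as p4.
    unfold al, ga, r, i in *. lra.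
  - set (P := u1 * u1 + u2 * u2). set (Q := v1 * v1 + v2 * v2).
    assert (hP : 0 <= P) by (unfold P; nra). assert (hQ : 0 <= Q) by (unfold Q; nra).
    assert (h5 : r * r + i * i <= eps / 2 * (eps / 2)) by lra.
    replace (eps * eps * (u1 * (u1 * 1) + u2 * (u2 * 1) + (v1 * (v1 * 1) + v2 * (v2 * 1)))) with
     (2 * (eps / 2 * (eps / 2) * P + eps / 2 * (eps / 2) * Q) + 2 * (eps / 2 * (eps / 2) * P + eps
       / 2 * (eps / 2) * Q))
     by (unfold P, Q; field).
    pose proof (Rmult_le_compat_r P _ _ hP h1). pose proof (Rmult_le_compat_r Q _ _ hQ h2).
    pose proof (Rmult_le_compat_r P _ _ hP h5). pose proof (Rmult_le_compat_r Q _ _ hQ h5). lra.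
Qed.

Lemma lower_bound_far z : bounded_below Us z -> exists c (n : nat), 0 < c /\ forall u : ell,
  (forall x, (sg * x < Z.of_nat n)%Z -> u x = vzero) -> c * nrm u <= nrm (shift U z u).
Proof.
  intros [c [hc h]]. destruct (asymptotic_closeness z (c / 2) ltac:(lra)) as [n hn].
  exists (c / 2), n. split; [lra|]. intros u hu. specialize (hn u hu). specialize (h u).
  pose proof (nrm_le_sub _ (shift Us z u) (shift U z u)) as k. rewrite nrm_sub_sym in k. lra.
Qed.

Variable tau : clin ell2.
Hypothesis tau_ev : forall (u : ell) x, ev (tau u) x = u (x - sg)%Z.
Hypothesis tau_nrm : forall u : ell, nrm (tau u) = nrm u.

(** A constant coin makes the walk commute with [tau], so an approximate eigenvector can be moved
    towards the end at no cost. *)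
Lemma translate (u : ell) k : exists v : ell, nrm v = nrm u /\
  (forall z, nrm (shift Us z v) = nrm (shift Us z u)) /\ forall x, v x = u (x - sg * Z.of_nat k)%Z.
Proof.
  induction k as [|k [v [h1 [h2 h3]]]].
  - exists u. repeat split. intro x. f_equal. lia.
  - exists (tau v). rewrite tau_nrm. split; [exact h1|]. split.
    + intro z. transitivity (nrm (tau (shift Us z v))); [|now rewrite tau_nrm, h2].
      f_equal. rewrite !shiftE, cl_sub, cl_csc. f_equal.
      apply ell_eq. intro x. rewrite tau_ev.
      change (susyqw p q (fun _ => c1) (fun _ => c2) (fun _ => d) (ev (tau v)) x =
              susyqw p q (fun _ => c1) (fun _ => c2) (fun _ => d) v (x - sg)%Z).
      unfold susyqw, gamma, coin. rewrite !tau_ev.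
      replace (x + 1 - sg)%Z with (x - sg + 1)%Z by lia.
      replace (x - 1 - sg)%Z with (x - sg - 1)%Z by lia.
      reflexivity.
    + intro x. rewrite tau_ev, h3. f_equal. lia.
Qed.

Lemma singular_exists z eta (n : nat) : 0 < eta -> ~ bounded_below Us z ->
  exists (u : ell) (M : nat),
  0 < nrm u /\ nrm (shift U z u) <= eta * nrm u /\
  (forall x, (sg * x < Z.of_nat n)%Z -> u x = vzero) /\ (forall x, (Z.of_nat M < Z.abs x)%Z ->
    u x = vzero).
Proof.
  intros heta hn. set (B := 1 + Cabs z).
  assert (hB : 1 <= B) by (unfold B; pose proof (Cabs_pos z); lra).
  (* Truncating [v] to [w] gives [|(Us - z) w| <= 2 c |v| <= 4 c |w|], that is [eta / 2] times
     [|w|]; replacing [Us] by [U] costs the other half. *)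
  set (c := eta / 8). assert (hc : 0 < c) by (unfold c; lra).
  assert (hv : exists v : ell, nrm (shift Us z v) < c * nrm v).
  { apply NNPP. intro h. apply hn. exists c. split; auto. intro u. apply Rnot_lt_le. intro k.
    apply h. now exists u. }
  destruct hv as [v hv].
  assert (hv0 : 0 < nrm v).
  { pose proof (nrm_pos _ (shift Us z v)). pose proof (nrm_pos _ v).
    destruct (Req_dec (nrm v) 0) as [e|e]; [rewrite e in hv; lra|lra]. }
  (* The bound 1/2 keeps [|v| <= 2 |w|], and [c / B] makes the image of the removed tail at most
     [c |v|]. *)
  set (dl := Rmin (1 / 2) (c / B)).
  assert (hcB : 0 < c / B) by (apply Rdiv_lt_0_compat; lra).
  assert (hdl : 0 < dl) by (apply Rmin_glb_lt; lra).
  assert (hdl1 : dl <= 1 / 2) by apply Rmin_l.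
  assert (hdl2 : B * dl <= c).
  { replace c with (B * (c / B)) by (field; lra). apply Rmult_le_compat_l; [lra|apply Rmin_r]. }
  destruct (cut_box_close v (dl * nrm v)) as [M0 hM0]; [nra|].
  set (w := cut (box M0) v) in *.
  assert (hw1 : nrm v <= 2 * nrm w) by (pose proof (nrm_le_sub _ v w); nra).
  assert (hw2 : nrm (shift Us z w) <= 2 * c * nrm v).
  { assert (k : bounded B (shift Us z)) by (apply shift_bounded; apply ip_walk).
    pose proof (nrm_le_sub _ (shift Us z w) (shift Us z v)) as k1.
    rewrite nrm_sub_sym, <- cl_sub in k1. specialize (k (v -' w)).
    assert (B * nrm (v -' w) <= B * (dl * nrm v)) by (apply Rmult_le_compat_l; lra). nra. }
  destruct (asymptotic_closeness z (eta / 2) ltac:(lra)) as [n0 hn0].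
  (* A box of radius [M0] moved by [k] lies beyond both [n0], where [U] is close to [Us], and the
     prescribed [n]. *)
  set (k := (M0 + n0 + n)%nat).
  destruct (translate w k) as [u [h1 [h2 h3]]].
  assert (hsupp : forall x, (Z.of_nat M0 < Z.abs (x - sg * Z.of_nat k))%Z -> u x = vzero).
  { intros x hx. rewrite h3. unfold w. rewrite ev_cut. unfold box.
    destruct (Z.leb_spec (Z.abs (x - sg * Z.of_nat k)) (Z.of_nat M0)); [lia|reflexivity]. }
  exists u, (M0 + k)%nat. split; [lra|]. split; [|split].
  - assert (hc1 : nrm (shift U z u -' shift Us z u) <= eta / 2 * nrm u).
    { apply hn0. intros x hx. apply hsupp. unfold k in *. destruct hsg; subst; lia. }
    pose proof (nrm_le_sub _ (shift U z u) (shift Us z u)) as k1. rewrite h2 in k1.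
    rewrite h1 in *. unfold c in *. nra.
  - intros x hx. apply hsupp. unfold k in *. destruct hsg; subst; lia.
  - intros x hx. apply hsupp. destruct hsg; subst; lia.
Qed.

Lemma side_essential z : spectrum (susyqw p q (fun _ => c1) (fun _ => c2) (fun _ => d)) z ->
  ess_spectrum T z.
Proof.
  intro h. pose proof (walk_spectrum_circle _ _ _ _ _ hpq (fun _ => limit_coin_ok) _ h) as hz.
  rewrite (walk_spectrum _ _ _ _ _ hpq (fun _ => limit_coin_ok)) in h. fold Us in h. split.
  - apply spec_res. intros [c [hc hr]].
    destruct (singular_exists z (c / 2) 0 ltac:(lra) h) as [u [M [h1 [h2 _]]]].
    specialize (hr u). nra.
  - apply (not_disc_of_singular z (fun eta n u => 0 < nrm u /\ nrm (shift U z u) <= eta * nrm u /\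
      (forall x, (sg * x < Z.of_nat n)%Z -> u x = vzero) /\
      exists M : nat, forall x, (Z.of_nat M < Z.abs x)%Z -> u x = vzero)); auto.
    + intros eta n he. destruct (singular_exists z eta n he h) as [u [M hu]]. exists u.
      destruct hu as [k1 [k2 [k3 k4]]]. split; auto. split; auto. split; auto. now exists M.
    + tauto.
    (* [u] lives in the box of radius [M]; starting [u'] at [M + 3] leaves more than two sites
       between them, and [+ n] keeps it beyond [n]. *)
    + intros eta n u he [k1 [k2 [k3 [M k4]]]]. exists (M + 3 + n)%nat.
      intros u' [l1 [l2 [l3 [M' l4]]]] al be hab.
      destruct (nrm_disjoint z u u' al be) as [e1 e2].
      { intros x y hxy. destruct (Z.lt_ge_cases (Z.of_nat M) (Z.abs x)) as [c|c]; [left;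
          now apply k4|].
        right. apply l3. destruct hsg; subst; lia. }
      set (v := al *' u +' be *' u') in *.
      assert (hv : 0 < ip v v).
      { rewrite e1, <- !nrm_sq.
        assert (s1 : 0 < nrm u * nrm u) by nra. assert (s2 : 0 < nrm u' * nrm u') by nra.
        pose proof (Rle_0_sqr al) as t1. pose proof (Rle_0_sqr be) as t2. unfold Rsqr in *.
        destruct hab as [c|c]; apply Rsqr_pos_lt in c; unfold Rsqr in c; nra. }
      assert (hv0 : 0 < nrm v) by (now apply sqrt_lt_R0).
      split; [exact hv0|]. split; [|split].
      * apply nrm_le_of_sq; [nra|].
        replace (eta * nrm v * (eta * nrm v)) with (eta * eta * (nrm v * nrm v)) by ring.
        rewrite nrm_sq, e1, e2. apply nrm_sq_le in k2. apply nrm_sq_le in l2.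
        replace (eta * nrm u * (eta * nrm u)) with (eta * eta * (nrm u * nrm u)) in k2 by ring.
        replace (eta * nrm u' * (eta * nrm u')) with (eta * eta * (nrm u' * nrm u')) in l2 by ring.
        rewrite nrm_sq in k2, l2.
        pose proof (Rmult_le_compat_l (al * al) _ _ (Rle_0_sqr al) k2).
        pose proof (Rmult_le_compat_l (be * be) _ _ (Rle_0_sqr be) l2). lra.
      * intros x hx. unfold v. rewrite ev_add, !ev_sc, k3, l3 by lia. vec_ring.
      * exists (M + M')%nat. intros x hx. unfold v. rewrite ev_add, !ev_sc, k4, l4 by lia. vec_ring.
Qed.

End Side.

(** A vector that vanishes on a large box is the sum of a left and a right half whose images are
    orthogonal, so the two one-sided bounds add up. The same estimate bounds the dimension of the
    kernel by the number of constraints. *)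
Lemma disc_of_lower_bounds z cl cr (nl nr : nat) : 0 < cl -> 0 < cr ->
  (forall u : ell, (forall x, (-1 * x < Z.of_nat nl)%Z -> u x = vzero) ->
    cl * nrm u <= nrm (shift U z u)) ->
  (forall u : ell, (forall x, (1 * x < Z.of_nat nr)%Z -> u x = vzero) ->
    cr * nrm u <= nrm (shift U z u)) ->
  spectrum T z -> disc_spectrum T z.
Proof.
  intros hcl hcr hl hr hs.
  assert (hz : Cabs z = 1) by (eapply walk_spectrum_circle; eauto).
  (* [nl + nr] brings each half into the range of its bound, and the extra 2 separates the halves
     enough for [nrm_disjoint]. *)
  set (N := (nl + nr + 2)%nat). set (c := Rmin cl cr).
  assert (hc : 0 < c) by (now apply Rmin_glb_lt).
  assert (hc1 : c <= cl) by apply Rmin_l. assert (hc2 : c <= cr) by apply Rmin_r.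
  assert (hout : forall u : ell, Forall (fun e => ip u e = 0) (box_basis N) ->
    c * nrm u <= nrm (shift U z u)).
  { intros u hu. pose proof (box_basis_orthogonal N u hu) as hu0.
    set (neg := fun x => (x <? 0)%Z). set (ul := cut neg u).
    set (ur := cut (fun x => negb (neg x)) u).
    assert (hul : forall x, (-1 * x <= Z.of_nat N)%Z -> ev ul x = vzero).
    { intros x hx. unfold ul. rewrite ev_cut. unfold neg. destruct (Z.ltb_spec x 0); auto.
      apply hu0. lia. }
    assert (hur : forall x, (x <= Z.of_nat N)%Z -> ev ur x = vzero).
    { intros x hx. unfold ur. rewrite ev_cut. unfold neg. destruct (Z.ltb_spec x 0); simpl; auto.
      apply hu0. lia. }
    assert (eu : u = 1 *' ul +' 1 *' ur).
    { apply ell_eq. intro x. rewrite ev_add, !ev_sc. unfold ul, ur. rewrite !ev_cut.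
      destruct (neg x); simpl; vec_ring. }
    destruct (nrm_disjoint z ul ur 1 1) as [e1 e2].
    { intros x y hxy. destruct (Z.le_gt_cases (-1 * x) (Z.of_nat N)) as [k|k]; [left;
        now apply hul|].
      right. apply hur. lia. }
    rewrite <- eu in e1, e2.
    specialize (hl ul ltac:(intros x hx; apply hul; unfold N; lia)).
    specialize (hr ur ltac:(intros x hx; apply hur; unfold N; lia)).
    pose proof (nrm_pos _ ul). pose proof (nrm_pos _ ur). pose proof (nrm_pos _ u).
    pose proof (nrm_pos _ (shift U z u)).
    apply Rsqr_incr_0_var; [|lra]. unfold Rsqr.
    replace (c * nrm u * (c * nrm u)) with (c * c * (nrm u * nrm u)) by ring.
    rewrite !nrm_sq, e1, e2, <- !nrm_sq.
    assert (k1 : c * nrm ul * (c * nrm ul) <= nrm (shift U z ul) * nrm (shift U z ul))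
      by (apply Rmult_le_compat; nra).
    assert (k2 : c * nrm ur * (c * nrm ur) <= nrm (shift U z ur) * nrm (shift U z ur))
      by (apply Rmult_le_compat; nra).
    lra. }
  apply disc_of_ker_bound; auto.
  - apply (ker_bound_of_finite_codim ell2 (shift U z) (1 + Cabs z) c (box_basis N)); auto.
    now apply shift_bounded.
  - now apply spec_res.
  - exists (box_basis N). intros u hu ho. apply nrm_zero_eq. specialize (hout u ho).
    rewrite hu, nrm_zero in hout. apply Rmult_le_reg_l with c; lra.
Qed.

End Walk.

Theorem theorem5p2 (p : R) (q : Cplx) (a1 a2 : Z -> R) (b : Z -> Cplx)
    (aL1 aL2 aR1 aR2 : R) (bL bR : Cplx)
    (hq : q <> C0) (hpq : p ^ 2 + Cnorm2 q = 1)
    (ha1 : forall x, a1 x ^ 2 + Cnorm2 (b x) = 1)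
    (ha2 : forall x, a2 x ^ 2 + Cnorm2 (b x) = 1)
    (hb : forall x, Cmul (b x) (RtoC (a1 x + a2 x)) = C0)
    (hL1 : lim_minus_R a1 aL1) (hL2 : lim_minus_R a2 aL2) (hLb : lim_minus_C b bL)
    (hR1 : lim_plus_R a1 aR1) (hR2 : lim_plus_R a2 aR2) (hRb : lim_plus_C b bR) :
  (forall z, ess_spectrum (susyqw p q a1 a2 b) z <->
      spectrum (susyqw p q (fun _ => aL1) (fun _ => aL2) (fun _ => bL)) z \/
      spectrum (susyqw p q (fun _ => aR1) (fun _ => aR2) (fun _ => bR)) z) /\
  (forall z, spectrum (susyqw p q (fun _ => aL1) (fun _ => aL2) (fun _ => bL)) z <->
      Cabs z = 1 /\ in_band p q aL1 aL2 bL (cre z)) /\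
  (forall z, spectrum (susyqw p q (fun _ => aR1) (fun _ => aR2) (fun _ => bR)) z <->
      Cabs z = 1 /\ in_band p q aR1 aR2 bR (cre z)).
Proof.
  assert (hC : forall x, coin_ok (a1 x) (a2 x) (b x)) by (intro x; repeat split; auto).
  assert (limL : forall eps, 0 < eps -> exists n : nat, forall x, (Z.of_nat n <= -1 * x)%Z ->
    Rabs (a1 x - aL1) < eps /\ Rabs (a2 x - aL2) < eps /\ Cabs (Csub (b x) bL) < eps).
  { intros e he. destruct (hL1 e he) as [n1 h1], (hL2 e he) as [n2 h2], (hLb e he) as [n3 h3].
    exists (Z.abs_nat n1 + Z.abs_nat n2 + Z.abs_nat n3)%nat. intros x hx.
    split; [|split]; [apply h1|apply h2|apply h3]; lia. }
  assert (limR : forall eps, 0 < eps -> exists n : nat, forall x, (Z.of_nat n <= 1 * x)%Z ->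
    Rabs (a1 x - aR1) < eps /\ Rabs (a2 x - aR2) < eps /\ Cabs (Csub (b x) bR) < eps).
  { intros e he. destruct (hR1 e he) as [n1 h1], (hR2 e he) as [n2 h2], (hRb e he) as [n3 h3].
    exists (Z.abs_nat n1 + Z.abs_nat n2 + Z.abs_nat n3)%nat. intros x hx.
    split; [|split]; [apply h1|apply h2|apply h3]; lia. }
  assert (sL : (-1 = 1 \/ -1 = -1)%Z) by auto. assert (sR : (1 = 1 \/ 1 = -1)%Z) by auto.
  pose proof (limit_coin_ok a1 a2 b hC (-1) aL1 aL2 bL sL limL) as okL.
  pose proof (limit_coin_ok a1 a2 b hC 1 aR1 aR2 bR sR limR) as okR.
  split; [|split; intro z; now apply constant_spectrum].
  intro z. split.
  - intros [hs hd]. apply NNPP. intro hc. apply hd.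
    (* The coin validity proof is the one from [limit_coin_ok], so that this walk is literally the
       [Us] of [lower_bound_far]. *)
    assert (rL : bounded_below (walk p q (fun _ => aL1) (fun _ => aL2) (fun _ => bL) hpq
       (fun _ => limit_coin_ok a1 a2 b hC (-1) aL1 aL2 bL sL limL)) z).
    { apply NNPP. intro k. apply hc. left. now apply walk_spectrum in k. }
    assert (rR : bounded_below (walk p q (fun _ => aR1) (fun _ => aR2) (fun _ => bR) hpq
       (fun _ => limit_coin_ok a1 a2 b hC 1 aR1 aR2 bR sR limR)) z).
    { apply NNPP. intro k. apply hc. right. now apply walk_spectrum in k. }
    apply lower_bound_far with (hC := hC) in rL. apply lower_bound_far with (hC := hC) in rR.
    destruct rL as [cl [nl [hcl hl]]], rR as [cr [nr [hcr hr]]].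
    now apply (disc_of_lower_bounds p q a1 a2 b hpq hC z cl cr nl nr).
  - intros [h|h].
    (* [left_shift] evaluates at [x + 1 = x - sg] and thus moves supports towards the left end. *)
    + eapply (side_essential p q a1 a2 b hpq hC (-1) aL1 aL2 bL sL limL left_shift);
        [|exact nrm_left_shift|exact h].
      reflexivity.
    + eapply (side_essential p q a1 a2 b hpq hC 1 aR1 aR2 bR sR limR right_shift);
        [|exact nrm_right_shift|exact h].
      reflexivity.
Qed.
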